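(* Let $u_h^{cr}\in K_h^{cr}$ be a minimizer of $I_h^{cr}$ and $z_h^{rt}\in K_h^{rt,*}$ the maximizer of $D_h^{rt}$. For every $v_h\in K_h^{cr}$ and $y_h\in K_h^{rt,*}$, we have $$\rho_{\mathrm{tot},h}^2(v_h,y_h)=\eta_{\mathrm{gap},h}^2(v_h,y_h),$$ where $\rho_{\mathrm{tot},h}^2(v_h,y_h)=\rho_{I_h^{cr}}^2(v_h)+\rho_{-D_h^{rt}}^2(y_h)$ with $\rho_{I_h^{cr}}^2(v_h)=I_h^{cr}(v_h)-I_h^{cr}(u_h^{cr})$ and $\rho_{-D_h^{rt}}^2(y_h)=-D_h^{rt}(y_h)+D_h^{rt}(z_h^{rt})$, and $\eta_{\mathrm{gap},h}^2(v_h,y_h)=I_h^{cr}(v_h)-D_h^{rt}(y_h)$.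
   Context: Setting. $\Omega\subseteq\mathbb{R}^d$, $d\in\mathbb{N}$, is a bounded simplicial (polyhedral) Lipschitz domain with outward unit normal $n$, whose boundary is split into three relatively open parts $\Gamma_I\neq\emptyset$, $\Gamma_D$, $\Gamma_N$, with $\partial\Omega=\overline{\Gamma}_I\cup\overline{\Gamma}_D\cup\overline{\Gamma}_N$. $(\cdot,\cdot)_\omega$ is the integral of the (Euclidean) product over $\omega$ (surface measure if $\omega\subseteq\partial\Omega$), $\|\cdot\|_{p,\omega}$ the $L^p(\omega)$-norm, $\|\cdot\|_\omega=\|\cdot\|_{2,\omega}$, $\langle v\rangle_\omega$ the integral mean. Mesh. $\mathcal{T}_h$ is a (conforming, simplicial) triangulation of $\Omega$ from a shape-regular family; $\mathcal{S}_h=\mathcal{S}_h^i\cup\mathcal{S}_h^\partial$ are its interior and boundary sides; $\mathcal{S}_h^X$, $X\in\{I,D,N\}$, are the boundary sides with interior contained in $\Gamma_X$, and $\mathcal{S}_h^\partial=\mathcal{S}_h^I\,\dot\cup\,\mathcal{S}_h^D\,\dot\cup\,\mathcal{S}_h^N$. $\mathcal{L}^k(\mathcal{T}_h)$ and $\mathcal{L}^k(\widehat{\mathcal{S}}_h)$ are the element-wise, resp. side-wise (on a set $\widehat{\mathcal S}_h$ of sides), polynomials of degree at most $k$. $\Pi_h$: element-wise mean, $\Pi_hv|_T=\langle v\rangle_T$; $\pi_h$: side-wise mean, $\pi_hv|_S=\langle v\rangle_S$ (componentwise for vector fields). Crouzeix–Raviart space: $\mathcal{S}^{1,cr}(\mathcal{T}_h)=\{v_h\in\mathcal{L}^1(\mathcal{T}_h):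 \text{the jump of }v_h\text{ across each }S\in\mathcal{S}_h^i\text{ has mean zero on }S\}$; $\nabla_h$ is the element-wise gradient. Raviart–Thomas space: $\mathcal{R}T^0(\mathcal{T}_h)=\{y_h\in(\mathcal{L}^1(\mathcal{T}_h))^d: y_h|_T\cdot n_T\text{ is constant on each side of }T\text{ for every }T\in\mathcal{T}_h,\text{ and the normal jump of }y_h\text{ vanishes across each }S\in\mathcal{S}_h^i\}$. Data: $m>0$, $f_h\in\mathcal{L}^0(\mathcal{T}_h)$, $g_h\in\mathcal{L}^0(\mathcal{S}_h^N)$, $u_D^h\in\mathcal{L}^0(\mathcal{S}_h^D)$. Discrete primal functional $I_h^{cr}\colon\mathcal{S}^{1,cr}(\mathcal{T}_h)\to\mathbb{R}\cup\{+\infty\}$: $I_h^{cr}(v_h)=\tfrac12\|\nabla_hv_h\|_\Omega^2+\tfrac1{2m}\|\pi_hv_h\|_{1,\Gamma_I}^2-(f_h,\Pi_hv_h)_\Omega-(g_h,\pi_hv_h)_{\Gamma_N}$ if $\pi_hv_h=u_D^h$ a.e. on $\Gamma_D$, and $+\infty$ otherwise. Its effective domain is $K_h^{cr}=\{v_h\in\mathcal{S}^{1,cr}(\mathcal{T}_h):\pi_hv_h=u_D^h\text{ a.e. on }\Gamma_D\}$. It has a minimizer $u_h^{cr}$. Discrete dual functional $D_h^{rt}\colon\mathcal{R}T^0(\mathcal{T}_h)\to\mathbb{R}\cup\{-\infty\}$: $D_h^{rt}(y_h)=-\tfrac12\|\Pi_hy_h\|_\Omega^2-\tfrac m2\|y_h\cdot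 n\|_{\infty,\Gamma_I}^2+(y_h\cdot n,u_D^h)_{\Gamma_D}$ if $y_h\in K_h^{rt,*}$, and $-\infty$ otherwise, where $K_h^{rt,*}=\{y_h\in\mathcal{R}T^0(\mathcal{T}_h):\mathrm{div}\,y_h=-f_h\text{ a.e. in }\Omega,\ y_h\cdot n=g_h\text{ a.e. on }\Gamma_N\}$. It has a unique maximizer $z_h^{rt}\in K_h^{rt,*}$. *)

(* Defs.v *)
From HB Require Import structures.
From mathcomp Require Import all_boot all_order all_algebra.
From mathcomp Require Import all_classical all_reals all_analysis.
Set Implicit Arguments.
Unset Strict Implicit.
Unset Printing Implicit Defensive.
Import Order.TTheory GRing.Theory Num.Theory.
Import numFieldNormedType.Exports.
Local Open Scope classical_set_scope.
Local Open Scope ring_scope.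

Section Euclidean.
Variables (R : realType) (d : nat).
Local Notation E := 'rV[R]_d.

Definition dotv (x y : E) : R := \sum_i x 0 i * y 0 i.
Definition enorm (x : E) : R := Num.sqrt (dotv x x).

Definition bdry (A : set E) : set E := closure A `\` interior A.

(* Near x, the set Om is the strict subgraph of g in the direction nu, inside
   an open cylinder.  The projection onto the hyperplane orthogonal to nu takes
   the place of the first d-1 local coordinates, so only the restriction of g
   to that hyperplane matters (every Lipschitz function on the hyperplane
   extends to E by composition with this projection). *)
Definition lipschitz_graph_at (Om : set E) (x : E) : Prop :=
  exists (nu : E) (r h L : R) (g : E -> R),
    let height z := dotv (z - x) nu in
    let proj z := (z - x) - height z *: nu in
    let cyl := [set z | enorm (proj z) < r /\ `|height z| < h] in
    [/\ enorm nu = 1, 0 < r /\ 0 < h,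
        forall p q, `|g p - g q| <= L * enorm (p - q),
        forall z, cyl z -> `|g (proj z)| < h
      & Om `&` cyl = [set z | cyl z /\ height z < g (proj z)] /\
        bdry Om `&` cyl = [set z | cyl z /\ height z = g (proj z)]].

Definition bounded_lipschitz_domain (Om : set E) : Prop :=
  [/\ Om !=set0, open Om, connected Om,
      exists C : R, forall x, Om x -> enorm x <= C
    & forall x, bdry Om x -> lipschitz_graph_at Om x].

Inductive part := GammaI | GammaD | GammaN.

Definition boundary_splitting (Om : set E) (Gam : part -> set E) : Prop :=
  [/\ Gam GammaI !=set0,
      forall X Y, X <> Y -> Gam X `&` Gam Y = set0,
      forall X, exists2 U, open U & Gam X = bdry Om `&` U
    & bdry Om = closure (Gam GammaI) `|` closure (Gam GammaD)
                `|` closure (Gam GammaN)].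

(* polynomial functions of degree at most k, in Horner form *)
Fixpoint poly_deg_le (k : nat) (p : E -> R) : Prop :=
  match k with
  | 0 => exists c, forall x, p x = c
  | k'.+1 => exists (c : R) (q : 'I_d -> E -> R),
      (forall i, poly_deg_le k' (q i)) /\
      forall x, p x = c + \sum_i x 0 i * q i x
  end.

Definition partial (p : E -> R) (i : 'I_d) (x : E) : R :=
  derive1 (fun t : R => p (x + t *: delta_mx 0 i)) 0.
Definition grad (p : E -> R) (x : E) : E := \row_i partial p i x.
Definition divg (w : E -> E) (x : E) : R :=
  \sum_i partial (fun y => w y 0 i) i x.

End Euclidean.

(* k-dimensional Lebesgue integral, as an iterated integral *)
Fixpoint iterated_integral (R : realType) (k : nat) : ('rV[R]_k -> R) -> R :=
  match k with
  | 0 => fun F => F 0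
  | k'.+1 => fun F =>
      Rintegral (@lebesgue_measure R) setT
        (fun t => iterated_integral (fun s : 'rV[R]_k' => F (row_mx t%:M s)))
  end.

Definition std_simplex (R : realType) (k : nat) : set 'rV[R]_k :=
  [set t | (forall i, 0 <= t 0 i) /\ \sum_i t 0 i <= 1].

Definition edge_mx (R : realType) (d k : nat) (a : nat -> 'rV[R]_d) :
  'M[R]_(k, d) := \matrix_(i < k) (a i.+1 - a 0%N).

(* Integral with respect to the k-dimensional surface measure over the simplex
   with vertices a 0, ..., a k: pull-back to the standard simplex, weighted by
   the square root of the Gram determinant.  For k = d the weight is the modulus
   of the Jacobian determinant; for k = 0 it is 1 (point evaluation). *)
Definition simplex_integral (R : realType) (d k : nat) (a : nat -> 'rV[R]_d)
    (f : 'rV[R]_d -> R) : R :=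
  let J := edge_mx k a in
  Num.sqrt (\det (J *m J^T)) *
  iterated_integral (fun t : 'rV[R]_k =>
    \1_(@std_simplex R k) t * f (a 0%N + t *m J)).

(* A simplex is represented by the set of its vertices. *)
Record mesh (R : realType) (d : nat) := Mesh {
  node : finType;
  pos : node -> 'rV[R]_d;
  elems : {set {set node}} }.

Section Mesh.
Variables (R : realType) (d : nat) (M : mesh R d).
Local Notation E := 'rV[R]_d.
Local Notation simplex := {set node M}.

Definition vertex (A : simplex) (i : nat) : E := [seq pos a | a <- enum A]`_i.

Definition hull (A : simplex) : set E :=
  [set x | exists l : node M -> R,
    [/\ forall a, a \in A -> 0 <= l a, \sum_(a in A) l a = 1
      & x = \sum_(a in A) l a *: pos a]].

Definition relint (A : simplex) : set E :=
  [set x | exists l : node M -> R,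
    [/\ forall a, a \in A -> 0 < l a, \sum_(a in A) l a = 1
      & x = \sum_(a in A) l a *: pos a]].

Definition triangulation (Om : set E) : Prop :=
  [/\ injective (@pos R d M),
      forall T, T \in elems M -> #|T| = d.+1 /\ row_free (edge_mx d (vertex T)),
      forall T T', T \in elems M -> T' \in elems M ->
        hull T `&` hull T' = hull (T :&: T')
    & closure Om = \bigcup_(T in [set T | T \in elems M]) hull T].

Definition sides : {set simplex} :=
  [set S : simplex | (#|S| == d) && [exists T in elems M, S \subset T]]%SET.

Definition isides : {set simplex} :=
  [set S in sides | [exists T in elems M, exists T' in elems M,
                      (T != T') && (S == T :&: T')]]%SET.

Definition bsides (Om : set E) : {set simplex} :=
  [set S in sides | `[< hull S `<=` bdry Om >]]%SET.

Definition psides (Om : set E) (Gam : part -> set E) (X : part) :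
    {set simplex} :=
  [set S in bsides Om | `[< relint S `<=` Gam X >]]%SET.

Definition boundary_fitted (Om : set E) (Gam : part -> set E) : Prop :=
  let SX := psides Om Gam in
  bsides Om = (SX GammaI :|: SX GammaD :|: SX GammaN)%SET /\
  forall X Y, X <> Y -> (SX X :&: SX Y)%SET = finset.set0.

Definition integral_on (A : simplex) (f : E -> R) : R :=
  simplex_integral #|A|.-1 (vertex A) f.
Definition mean (A : simplex) (f : E -> R) : R :=
  integral_on A f / integral_on A (fun=> 1).
Definition ae_on (A : simplex) (P : E -> Prop) : Prop :=
  integral_on A (\1_[set x | ~ P x]) = 0.

(* Piecewise functions: one function on E per simplex, of which only the values
   on that simplex matter.  The same type serves for functions on elements and
   for functions on sides. *)
Definition pwfun := simplex -> E -> R.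
Definition pwvec := simplex -> E -> E.

Implicit Types (C : {set simplex}) (f g v : pwfun) (w y : pwvec).

(* products and norms over the union of the simplices in C *)
Definition inner C f g : R :=
  \sum_(A in C) integral_on A (fun x => f A x * g A x).
Definition L1norm C f : R := \sum_(A in C) integral_on A (fun x => `|f A x|).
Definition L2norm C w : R :=
  Num.sqrt (\sum_(A in C) integral_on A (fun x => dotv (w A x) (w A x))).
Definition Linfnorm C f : R :=
  inf [set c | 0 <= c /\ forall A, A \in C -> ae_on A (fun x => `|f A x| <= c)].

Definition pwpoly (k : nat) C : set pwfun :=
  [set v : pwfun | forall A, A \in C -> poly_deg_le k (v A)].

Definition pwgrad v : pwvec := fun T => grad (v T).
Definition Pih v : pwfun := fun T _ => mean T (v T).
Definition Pihv w : pwvec := fun T _ => \row_i mean T (fun x => w T x 0 i).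

(* An element having S as a side.  For a boundary side this element is unique.
   For an interior side one of the two neighbours is selected. *)
Definition neighbour (S : simplex) : simplex :=
  odflt finset.set0 [pick T in elems M | S \subset T].

Definition outer_normal (T S : simplex) : E :=
  xget 0 [set n : E |
    [/\ enorm n = 1,
        forall a b, a \in S -> b \in S -> dotv n (pos a - pos b) = 0
      & forall a b, a \in T :\: S -> b \in S -> dotv n (pos a - pos b) < 0]].

(* side-wise mean of the trace (on interior sides of a Crouzeix-Raviart
   function it does not depend on the neighbour) *)
Definition pih v : pwfun := fun S _ => mean S (v (neighbour S)).

(* normal trace y . n on boundary sides *)
Definition ntrace y : pwfun :=
  fun S x => dotv (y (neighbour S) x) (outer_normal (neighbour S) S).

Definition CR : set pwfun :=
  [set v : pwfun | pwpoly 1 (elems M) v /\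
    forall S T T', S \in isides -> T \in elems M -> T' \in elems M ->
      T != T' -> S \subset T -> S \subset T' ->
      mean S (fun x => v T x - v T' x) = 0].

Definition RT : set pwvec :=
  [set y : pwvec | [/\ forall i, pwpoly 1 (elems M) (fun T x => y T x 0 i),
    forall T S, T \in elems M -> S \in sides -> S \subset T ->
      exists c, forall x, hull S x -> dotv (y T x) (outer_normal T S) = c
  & forall S T T', S \in isides -> T \in elems M -> T' \in elems M ->
      T != T' -> S \subset T -> S \subset T' ->
      forall x, hull S x ->
        dotv (y T x) (outer_normal T S) + dotv (y T' x) (outer_normal T' S)
        = 0]].

Section Functionals.
Variables (Om : set E) (Gam : part -> set E) (m : R) (fh gh uD : pwfun).
Local Notation Th := (elems M).
Local Notation SI := (psides Om Gam GammaI).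
Local Notation SD := (psides Om Gam GammaD).
Local Notation SN := (psides Om Gam GammaN).

Definition dirichlet v : Prop :=
  forall S, S \in SD -> ae_on S (fun x => pih v S x = uD S x).

Definition Kcr : set pwfun := [set v : pwfun | CR v /\ dirichlet v].

Definition Icr v : \bar R :=
  if `[< dirichlet v >] then
    (1 / 2 * L2norm Th (pwgrad v) ^+ 2
     + 1 / (2 * m) * L1norm SI (pih v) ^+ 2
     - inner Th fh (Pih v) - inner SN gh (pih v))%:E
  else +oo%E.

Definition Krt : set pwvec :=
  [set y : pwvec | [/\ RT y,
    forall T, T \in Th -> ae_on T (fun x => divg (y T) x = - fh T x)
  & forall S, S \in SN -> ae_on S (fun x => ntrace y S x = gh S x)]].

Definition Drt y : \bar R :=
  if `[< Krt y >] then
    (- (1 / 2) * L2norm Th (Pihv y) ^+ 2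
     - m / 2 * Linfnorm SI (ntrace y) ^+ 2
     + inner SD (ntrace y) uD)%:E
  else -oo%E.

Definition primal_minimizer u : Prop :=
  Kcr u /\ forall v, CR v -> (Icr u <= Icr v)%E.

Definition dual_maximizer z : Prop :=
  Krt z /\ forall y, RT y -> (Drt y <= Drt z)%E.

Definition rho2_I u v : \bar R := (Icr v - Icr u)%E.
Definition rho2_D z y : \bar R := (- Drt y + Drt z)%E.
Definition rho2_tot u z v y : \bar R := (rho2_I u v + rho2_D z y)%E.
Definition eta2_gap v y : \bar R := (Icr v - Drt y)%E.

End Functionals.
End Mesh.

(* Main.v *)
(* Both sides of the identity differ by [I u - D z], so the content is strong
   duality without gap.  Only integrals of affine functions over elements and
   sides occur; these are volume times value at the barycenter, and the relation
   |S| = d |T| |grad lambda| between the volume of a facet and the gradient of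
   the barycentric coordinate vanishing on it turns integration by parts on an
   element into an identity between nodal values.  Summing over the elements,
   interior sides cancel, and weak duality follows from Young's inequality.
   For the converse, the side means are independent degrees of freedom of the
   Crouzeix-Raviart space, so the optimality of [u] can be tested one side at a
   time.  This says exactly that Marini's field
   grad u - f / d (x - x_T) has continuous normal components, the prescribed flux
   on Gamma_N and, on Gamma_I, a flux bounded by the L1 norm of [u] over m with
   equality where [u] does not vanish; hence it is admissible and its dual value
   is at least [I u]. *)
Require Import Defs.
From HB Require Import structures.
From mathcomp Require Import all_boot all_order all_fingroup all_algebra.
From mathcomp Require Import all_classical all_reals all_analysis.
From mathcomp Require Import ring lra.
Set Implicit Arguments.
Unset Strict Implicit.
Unset Printing Implicit Defensive.
Import Order.TTheory GRing.Theory Num.Theory.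
Import numFieldNormedType.Exports.
Local Open Scope classical_set_scope.
Local Open Scope ring_scope.

(** * Affine functions on simplices *)

(** Two obstacles shape the proof. The integrals are iterated Lebesgue integrals of an indicator
    times a function, so one exact computation, for affine functions on a scaled simplex, has to
    precede everything else. And boundary sides are defined topologically, by inclusion in the
    boundary of [Om], whereas the cancellation in Green's formula depends on how many elements
    contain a side. The two views are matched by following short rays from points of a side; the
    graph property of the boundary rules out a slit, that is, a boundary side with elements on both
    sides. The penalty on Gamma_I is the square of a sum and so couples all its sides. Changing one
    side mean alters a single summand of that sum, which leaves a problem in one real variable with
    an absolute value inside a square. The factor 1/d in Marini's field comes from div x = d, and
    centring at x_T makes its mean on each element equal to the gradient of [u]. This is why the
    Dirichlet terms of the primal and dual values match. *)

Lemma Rintegral_deriv_poly (R : realType) (p : {poly R}) (r : R) : 0 <= r ->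
  Rintegral (@lebesgue_measure R) `[0, r] (horner (p^`())%R) = p.[r] - p.[0].
Proof.
rewrite le_eqVlt => /predU1P[<-|r_gt0].
  by rewrite set_itv1 Rintegral_set1 subrr.
rewrite /Rintegral (@continuous_FTC2 _ _ (horner p)) //.
- by apply: continuous_subspaceT => x; exact: continuous_horner.
- split=> [x _| |].
  + exact: derivable_horner.
  + by apply: cvg_at_right_filter; exact: continuous_horner.
  + by apply: cvg_at_left_filter; exact: continuous_horner.
- by move=> x _; rewrite derivE.
Qed.

(** The size [r] is variable because the slice of a simplex at first coordinate x is again a
    simplex, of size r - x; the induction on the dimension needs this. *)
Definition scaled_simplex (R : realType) (k : nat) (r : R) : set 'rV[R]_k :=
  [set t | (forall i, 0 <= t 0 i) /\ \sum_i t 0 i <= r].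

Lemma scaled_simplexS (R : realType) (k : nat) (r x : R) (s : 'rV[R]_k) :
  scaled_simplex r (row_mx x%:M s) <->
  0 <= x /\ scaled_simplex (r - x) s.
Proof.
have E0 : (row_mx x%:M s : 'rV[R]_(1 + k)) 0 (lshift k 0) = x.
  by rewrite row_mxEl mxE eqxx.
have E1 j : (row_mx x%:M s : 'rV[R]_(1 + k)) 0 (rshift 1 j) = s 0 j.
  by rewrite row_mxEr.
rewrite /scaled_simplex /= big_split_ord /= big_ord1 E0.
under eq_bigr do rewrite E1.
rewrite lerBrDl; split=> [[h ->]|[x0 [h ->]]].
  split; first by rewrite -E0.
  by split=> // i; rewrite -E1.
split=> // i; case: (split_ordP i) => j ->; first by rewrite (ord1 j) E0.
by rewrite E1.
Qed.

Lemma eq_iterated_integral (R : realType) (k : nat) (F G : 'rV[R]_k -> R) :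
  F =1 G -> iterated_integral F = iterated_integral G.
Proof. by move=> /funext ->. Qed.

(** The differentiation step for the antiderivative in the next computation, with the factorials
    absorbed into the common factor [h]. *)
Lemma deriv_affine_mul_exp (R : comNzRingType) (q : {poly R}) (c b h a : R)
    (k : nat) : q^`() = 1 ->
  ((k.+2%:R * h) *: ((c%:P + b *: 'X) * q ^+ k.+1) - ((b + a) * h) *: q ^+ k.+2)^`()
  = (k.+1%:R * (k.+2%:R * h)) *: ((c%:P + b *: 'X) * q ^+ k)
    - (a * (k.+2%:R * h)) *: q ^+ k.+1.
Proof.
move=> dq.
rewrite derivB !derivZ derivM !deriv_exp derivD derivC derivZ derivX dq /=.
rewrite -!mul_polyC !polyCM !polyCD !polyC_natr.
by rewrite exprS; ring.
Qed.

Lemma iterated_integral_scaled_simplex (R : realType) (k : nat) (r c : R)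
    (b : 'rV[R]_k) :
  iterated_integral (fun t => \1_(scaled_simplex r) t * (c + dotv t b)) =
  if 0 <= r then
    c * r ^+ k / k`!%:R + (\sum_i b 0 i) * r ^+ k.+1 / k.+1`!%:R
  else 0.
Proof.
elim: k r c b => [|k IH] r c b.
  rewrite /= /dotv !big_ord0 addr0 mul0r mul0r addr0 expr0 fact0 divr1 mulr1.
  rewrite indicE; case: ifPn => r0.
    by rewrite mem_set ?mul1r //; split; [case|rewrite big_ord0].
  by rewrite memNset ?mul0r // => -[_]; rewrite big_ord0; apply/negP.
rewrite [LHS]/=.
pose b0 := b 0 (lshift k (0 : 'I_1)).
pose b' : 'rV[R]_k := \row_j b 0 (rshift 1 j).
have inner x : iterated_integral (fun s : 'rV[R]_k =>
    \1_(scaled_simplex r) (row_mx x%:M s : 'rV_(1 + k)) *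
      (c + dotv (row_mx x%:M s : 'rV_(1 + k)) b)) =
    if (0 <= x) && (x <= r) then
      (c + x * b0) * (r - x) ^+ k / k`!%:R +
      (\sum_i b' 0 i) * (r - x) ^+ k.+1 / k.+1`!%:R else 0.
  have [x0|x0] := boolP (0 <= x).
    rewrite -subr_ge0 -IH; apply: eq_iterated_integral => s.
    congr (_ * _).
      by rewrite !indicE; congr (nat_of_bool _)%:R; apply/idP/idP => /set_mem H;
        apply/mem_set; [case/scaled_simplexS: H|apply/scaled_simplexS].
    rewrite /dotv [in LHS]big_split_ord /= big_ord1 row_mxEl mxE eqxx mulr1n addrA.
    by congr (_ + _); apply: eq_bigr => i _; rewrite row_mxEr mxE.
  (* For x < 0 the slice is empty although r - x may be nonnegative. The zero integrand is written
     over a simplex of size -1, where the induction hypothesis gives 0. *)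
  rewrite /= [X in iterated_integral X](_ : _ = fun s =>
      \1_(scaled_simplex (-1)) s * (0 + dotv s 0)).
    by rewrite IH oppr_ge0 ler10.
  apply: funext => s; rewrite !indicE memNset; last first.
    by move=> /scaled_simplexS[x0']; rewrite x0' in x0.
  rewrite mul0r add0r /dotv big1 ?mulr0 // => i _.
  by rewrite mxE mulr0.
under [X in Rintegral _ _ X]funext do rewrite inner.
pose q : {poly R} := 'X - r%:P.
pose B := \sum_i b' 0 i.
pose s : R := (-1) ^+ k.
(* The antiderivative obtained by integrating by parts; [q = 'X - r], so that
   [(r - x) ^+ k = s * q.[x] ^+ k]. *)
pose P : {poly R} := (s / k.+1`!%:R) *: ((c%:P + b0 *: 'X) * q ^+ k.+1)
   - ((b0 + B) * s / k.+2`!%:R) *: q ^+ k.+2.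
have dP : P^`() = (s / k`!%:R) *: ((c%:P + b0 *: 'X) * q ^+ k)
   - (B * s / k.+1`!%:R) *: q ^+ k.+1.
  have eS j : s / j`!%:R = j.+1%:R * (s / j.+1`!%:R).
    have : j`!%:R != 0 :> R by rewrite pnatr_eq0 -lt0n fact_gt0.
    have : j.+1%:R != 0 :> R by rewrite pnatr_eq0.
    rewrite factS natrM; move: (j.+1%:R) (j`!%:R) => x y x0 y0.
    by field; rewrite ?x0 ?y0.
  rewrite -!mulrA eS [s / k.+1`!%:R]eS /P eS -[_ * s / _]mulrA; set h := s / _.
  by apply: deriv_affine_mul_exp; rewrite derivB derivX derivC subr0.
have evP x : (P^`()).[x] = (c + x * b0) * (r - x) ^+ k / k`!%:R +
    (\sum_i b' 0 i) * (r - x) ^+ k.+1 / k.+1`!%:R.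
  rewrite dP !hornerE -/B.
  have -> : r - x = - (x - r) by rewrite opprB.
  rewrite !(exprNn (x - r)) /s !exprS /=.
  by move: (k`!%:R^-1) (k.+1`!%:R^-1) => f1 f2; ring.
have -> : Rintegral (@lebesgue_measure R) setT
    (fun x => if (0 <= x) && (x <= r) then
      (c + x * b0) * (r - x) ^+ k / k`!%:R +
      (\sum_i b' 0 i) * (r - x) ^+ k.+1 / k.+1`!%:R else 0) =
    Rintegral (@lebesgue_measure R) `[0, r] (horner (P^`())%R).
  rewrite [RHS]Rintegral_mkcond; congr (Rintegral _ _ _); apply: funext => x.
  rewrite patchE mem_setE (_ : (x \in `[0, r]) = (0 <= x) && (x <= r)).
    by case: ifP => // _; exact/esym/evP.
  by rewrite in_itv.
have [r0|r0] := boolP (0 <= r); last first.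
  rewrite set_itv_ge ?Rintegral_set0 // bnd_simp; exact: r0.
have qr : q.[r] = 0 by rewrite /q !hornerE subrr.
have q0 : q.[0] = - r by rewrite /q !hornerE.
clearbody q.
have e1 (y : R) : y ^+ k.+1 = y * y ^+ k by rewrite exprS.
have e2 (y : R) : y ^+ k.+2 = y * (y * y ^+ k) by rewrite !exprS.
rewrite Rintegral_deriv_poly // /P.
rewrite !(horner_exp, hornerD, hornerN, hornerZ, hornerM, hornerX, hornerC).
rewrite qr q0 !e2 !e1 !(mul0r, mulr0).
rewrite !(exprNn r) (@big_split_ord _ _ _ 1 k) big_ord1 -/b0.
have -> : \sum_(i < k) b 0 (rshift 1 i) = B by apply: eq_bigr => i _; rewrite mxE.
have := sqrr_sign R k; rewrite expr2.
move: (k.+1`!%:R^-1) (k.+2`!%:R^-1) (r ^+ k) => f1 f2 rk.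
rewrite /s; move: ((-1) ^+ k) => e ee /=.
(* The sign e = (-1)^k occurs twice on the left, from [s] and from the powers of -r; inserting e * e
   = 1 on the right lets [ring] match them. *)
have -> : c * (r * rk) * f1 + (b0 + B) * (r * (r * rk)) * f2 =
  (e * e) * (c * (r * rk) * f1 + (b0 + B) * (r * (r * rk)) * f2).
  by rewrite ee mul1r.
by ring.
Qed.

(** * Bilinearity of the Euclidean product *)

Section EuclideanAlgebra.
Variables (R : realType) (d : nat).
Implicit Types x y w : 'rV[R]_d.

Lemma dotvE x y : dotv x y = (x *m y^T) 0 0.
Proof. by rewrite mxE; apply: eq_bigr => i _; rewrite mxE. Qed.

Lemma dotvC x y : dotv x y = dotv y x.
Proof. by apply: eq_bigr => i _; rewrite mulrC. Qed.

Lemma dotvDl x y w : dotv (x + y) w = dotv x w + dotv y w.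
Proof. by rewrite !dotvE mulmxDl mxE. Qed.

Lemma dotvNl x w : dotv (- x) w = - dotv x w.
Proof. by rewrite !dotvE mulNmx mxE. Qed.

Lemma dotvBl x y w : dotv (x - y) w = dotv x w - dotv y w.
Proof. by rewrite dotvDl dotvNl. Qed.

Lemma dotvZl a x w : dotv (a *: x) w = a * dotv x w.
Proof. by rewrite !dotvE -scalemxAl mxE. Qed.

Lemma dotv0l w : dotv 0 w = 0.
Proof. by rewrite dotvE mul0mx mxE. Qed.

Lemma dotv_suml (I : Type) (r : seq I) (P : pred I) (F : I -> 'rV[R]_d) w :
  dotv (\sum_(i <- r | P i) F i) w = \sum_(i <- r | P i) dotv (F i) w.
Proof.
by elim/big_rec2: _ => [|i y1 y2 _ <-]; rewrite ?dotv0l ?dotvDl.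
Qed.

Lemma dotvDr x y w : dotv w (x + y) = dotv w x + dotv w y.
Proof. by rewrite !(dotvC w) dotvDl. Qed.

Lemma dotvNr x w : dotv w (- x) = - dotv w x.
Proof. by rewrite !(dotvC w) dotvNl. Qed.

Lemma dotvBr x y w : dotv w (x - y) = dotv w x - dotv w y.
Proof. by rewrite !(dotvC w) dotvBl. Qed.

Lemma dotvZr a x w : dotv w (a *: x) = a * dotv w x.
Proof. by rewrite !(dotvC w) dotvZl. Qed.

Lemma dotv0r w : dotv w 0 = 0.
Proof. by rewrite dotvC dotv0l. Qed.

Lemma dotv_sumr (I : Type) (r : seq I) (P : pred I) (F : I -> 'rV[R]_d) w :
  dotv w (\sum_(i <- r | P i) F i) = \sum_(i <- r | P i) dotv w (F i).
Proof. by rewrite dotvC dotv_suml; apply: eq_bigr => i _; rewrite dotvC. Qed.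

Lemma dotv_ge0 x : 0 <= dotv x x.
Proof. by apply: sumr_ge0 => i _; rewrite -expr2 sqr_ge0. Qed.

Lemma dotv_eq0 x : (dotv x x == 0) = (x == 0).
Proof.
apply/eqP/eqP => [h|->]; last exact: dotv0l.
have x2 i : 0 <= x 0 i * x 0 i by rewrite -expr2 sqr_ge0.
apply/rowP => i; rewrite mxE; have := psumr_eq0P (fun i _ => x2 i) h (i := i) isT.
by move/eqP; rewrite mulf_eq0 orbb => /eqP.
Qed.

Lemma enorm_ge0 x : 0 <= enorm x.
Proof. exact: sqrtr_ge0. Qed.

Lemma sqr_enorm x : enorm x ^+ 2 = dotv x x.
Proof. exact/sqr_sqrtr/dotv_ge0. Qed.

Lemma enorm0 : enorm (0 : 'rV[R]_d) = 0.
Proof. by rewrite /enorm dotv0l sqrtr0. Qed.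

Lemma enormZ a x : enorm (a *: x) = `|a| * enorm x.
Proof.
by rewrite /enorm dotvZl dotvZr mulrA -expr2 sqrtrM ?sqr_ge0 // sqrtr_sqr.
Qed.

Lemma enorm_gt0 x : (0 < enorm x) = (x != 0).
Proof. by rewrite sqrtr_gt0 lt_def dotv_ge0 andbT dotv_eq0. Qed.

Lemma dotv_delta x i : dotv x (delta_mx 0 i) = x 0 i.
Proof.
rewrite /dotv (bigD1 i) //= mxE !eqxx mulr1 big1 ?addr0 // => j ji.
by rewrite mxE (negbTE ji) mulr0.
Qed.

End EuclideanAlgebra.

(** * Integrals and means of affine functions over a simplex *)

Section SimplexIntegral.
Variables (R : realType) (d : nat) (M : mesh R d).
Local Notation E := 'rV[R]_d.
Implicit Types (A : {set node M}) (f g : E -> R).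

Definition vol A : R := integral_on A (fun=> 1).
Definition bary A : E := #|A|%:R^-1 *: \sum_(a in A) pos a.

Lemma vertexE A (a0 : node M) i : (i < #|A|)%N ->
  vertex A i = pos (nth a0 (enum A) i).
Proof. by move=> iA; rewrite /vertex (nth_map a0) // -cardE. Qed.

Lemma sum_vertex (V : nmodType) A (a0 : node M) (F : node M -> V) :
  \sum_(a in A) F a = \sum_(i < #|A|) F (nth a0 (enum A) i).
Proof.
by rewrite -big_enum /= (big_nth a0) -cardE big_mkord.
Qed.

Lemma param_in_hull A k (t : 'rV[R]_k) : #|A| = k.+1 ->
  std_simplex t -> hull A (vertex A 0 + t *m edge_mx k (vertex A)).
Proof.
move=> cA [t0 t1].
have /card_gt0P[a0 a0A] : (0 < #|A|)%N by rewrite cA.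
(* Barycentric coordinates of the image of [t], listed by position in [enum A]: vertex 0 receives
   what the coordinates of [t] leave over from 1. *)
pose lam (i : nat) : R :=
  (if i is j.+1 then [seq t 0 i | i <- enum 'I_k]`_j else 1 - \sum_i t 0 i).
have lamS (i : 'I_k) : lam (lift ord0 i) = t 0 i.
  by rewrite lift0 /lam (nth_map i) ?size_enum_ord // nth_ord_enum.
have idx (i : 'I_k.+1) : index (nth a0 (enum A) i) (enum A) = i.
  by rewrite index_uniq ?enum_uniq // -cardE cA.
exists (fun a => lam (index a (enum A))); split.
- move=> a aA.
  have : (index a (enum A) < k.+1)%N by rewrite -cA cardE index_mem mem_enum.
  case: (index a (enum A)) => [_|j jk]; first by rewrite subr_ge0.
  by have := lamS (Ordinal (jk : (j < k)%N)); rewrite lift0 => ->.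
- rewrite (sum_vertex _ a0) cA.
  under eq_bigr do rewrite idx.
  rewrite big_ord_recl.
  under eq_bigr do rewrite lamS.
  by rewrite subrK.
- rewrite (sum_vertex _ a0) cA.
  under eq_bigr => i _ do rewrite idx -vertexE ?cA //.
  rewrite big_ord_recl; under eq_bigr => i _ do rewrite lamS.
  rewrite -[lam ord0]/(1 - \sum_i t 0 i) scalerBl scale1r -addrA.
  congr (_ + _).
  rewrite scaler_suml -sumrN -big_split /= mulmx_sum_row.
  by apply: eq_bigr => i _; rewrite rowK scalerBr addrC.
Qed.

Lemma eq_integral_on A f g : (0 < #|A|)%N ->
  (forall x, hull A x -> f x = g x) -> integral_on A f = integral_on A g.
Proof.
move=> A0 fg; rewrite /integral_on /simplex_integral; congr (_ * _).
apply: eq_iterated_integral => t; rewrite indicE.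
have [/set_mem tS|_] := boolP (t \in _); last by rewrite !mul0r.
by rewrite fg //; apply: param_in_hull => //; rewrite prednK.
Qed.

Lemma volE A k : #|A| = k.+1 ->
  vol A = Num.sqrt (\det (edge_mx k (vertex A) *m (edge_mx k (vertex A))^T))
          / k`!%:R.
Proof.
move=> cA; rewrite /vol /integral_on /simplex_integral cA /=; congr (_ * _).
rewrite -[RHS](_ : 1 * 1 ^+ k / k`!%:R + 0 = _); last first.
  by rewrite expr1n mulr1 mul1r addr0.
have := iterated_integral_scaled_simplex 1 1 (0 : 'rV[R]_k).
rewrite ler01 big1 ?mul0r => [|i _]; last by rewrite mxE.
move=> <-; apply: eq_iterated_integral => t.
by rewrite dotv0r addr0 mulr1.
Qed.

Lemma dotv_bary A b :
  dotv (bary A) b = #|A|%:R^-1 * \sum_(a in A) dotv (pos a) b.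
Proof. by rewrite dotvZl dotv_suml. Qed.

Lemma integral_on_affine A f c b : (0 < #|A|)%N ->
  (forall x, hull A x -> f x = c + dotv x b) ->
  integral_on A f = vol A * (c + dotv (bary A) b).
Proof.
move=> A0 /(eq_integral_on A0) ->.
have /card_gt0P[a0 a0A] := A0.
have cA : #|A| = #|A|.-1.+1 by rewrite prednK.
move: #|A|.-1 cA => k cA.
rewrite (volE cA) // /integral_on /simplex_integral cA /= -mulrA; congr (_ * _).
set J := edge_mx _ _.
rewrite (_ : (fun t => _) = fun t => \1_(scaled_simplex 1) t *
    ((c + dotv (vertex A 0) b) + dotv t (b *m J^T))); last first.
  apply: funext => t; congr (_ * _); rewrite -addrA dotvDl; congr (_ + (_ + _)).
  by rewrite !dotvE trmx_mul trmxK mulmxA.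
rewrite iterated_integral_scaled_simplex ler01 !expr1n !mulr1.
rewrite dotv_bary (sum_vertex _ a0) cA.
under [in RHS]eq_bigr => i _ do rewrite -vertexE ?cA //.
rewrite big_ord_recl.
have -> : \sum_i (b *m J^T) 0 i =
    \sum_(i < k) dotv (vertex A (lift ord0 i)) b - k%:R * dotv (vertex A 0) b.
  rewrite mulr_natl -[in X in _ - X](card_ord k) -sumr_const -sumrB.
  apply: eq_bigr => i _; rewrite -dotvBl dotvC dotvE mxE [in RHS]mxE.
  by apply: eq_bigr => j _; rewrite !mxE.
move: (\sum_i _) (dotv _ b) => s v.
have : k`!%:R != 0 :> R by rewrite pnatr_eq0 -lt0n fact_gt0.
have : k.+1%:R != 0 :> R by rewrite pnatr_eq0.
rewrite factS natrM -natr1; move: (k%:R) (k`!%:R) => x y x0 y0.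
by field; rewrite ?x0 ?y0.
Qed.

Lemma mean_affine A f c b : (0 < #|A|)%N -> vol A != 0 ->
  (forall x, hull A x -> f x = c + dotv x b) ->
  mean A f = c + dotv (bary A) b.
Proof.
move=> A0 vA /(integral_on_affine A0).
by rewrite /mean -/(vol A) => ->; rewrite mulrC mulKf.
Qed.

Lemma integral_on_cst A f c : (0 < #|A|)%N ->
  (forall x, hull A x -> f x = c) -> integral_on A f = vol A * c.
Proof.
move=> A0 fc; rewrite (@integral_on_affine _ _ c 0) //.
  by rewrite dotv0r addr0.
by move=> x /fc ->; rewrite dotv0r addr0.
Qed.

(** Turns the almost-everywhere conditions on piecewise constant quantities into single equations:
    where such a condition fails, it fails on the whole simplex, whose volume is nonzero. *)
Lemma ae_on_cst A (P : E -> Prop) (Q : Prop) : (0 < #|A|)%N -> vol A != 0 ->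
  (forall x, hull A x -> P x <-> Q) -> ae_on A P <-> Q.
Proof.
move=> A0 vA PQ; rewrite /ae_on.
have [q|nq] := pselect Q.
  rewrite (@integral_on_cst _ _ 0) ?mulr0 // => x /PQ Px.
  by rewrite indicE memNset //= => nPx; exact/nPx/Px.
rewrite (@integral_on_cst _ _ 1) // => [|x /PQ Px].
  by rewrite mulr1; split=> // /eqP; rewrite (negbTE vA).
by rewrite indicE mem_set //= => /Px.
Qed.

End SimplexIntegral.

(** * Barycentric coordinates, facets and normals *)

(** With a column of ones added, reordering the vertices becomes a permutation of rows, which
    changes the determinant by a sign at most. It frees later arguments from the order chosen by
    [enum]. *)
Lemma sqr_det_edge_mx_perm (R : realType) (d : nat) (s s' : seq 'rV[R]_d) :
  size s = d.+1 -> perm_eq s s' ->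
  \det (edge_mx d (nth 0 s)) ^+ 2 = \det (edge_mx d (nth 0 s')) ^+ 2.
Proof.
move=> ss ps.
pose V (s : seq 'rV[R]_d) : 'M[R]_(1 + d) :=
  \matrix_(i, j) (row_mx 1%:M s`_i : 'rV[R]_(1 + d)) 0 j.
have detV u : \det (V u) = \det (edge_mx d (nth 0 u)).
  (* Multiplication by [L] subtracts the first row from the others and so produces the edge
     vectors. *)
  pose L : 'M[R]_(1 + d) := block_mx 1%:M 0 (const_mx (-1)) 1%:M.
  have detL : \det L = 1 by rewrite det_lblock !det1 mulr1.
  rewrite -[LHS]mul1r -detL -det_mulmx.
  have -> : V u = block_mx 1%:M u`_0 (const_mx 1) (\matrix_(i < d) u`_i.+1).
    apply/matrixP => i j; rewrite mxE.
    case: (split_ordP i) => i' ->; case: (split_ordP j) => j' ->.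
    - by rewrite block_mxEul row_mxEl (ord1 i').
    - by rewrite block_mxEur row_mxEr (ord1 i').
    - by rewrite block_mxEdl row_mxEl !mxE (ord1 j').
    - by rewrite block_mxEdr row_mxEr mxE.
  rewrite mulmx_block !mul0mx !mul1mx !addr0 mulmx1.
  have -> : const_mx (-1) + const_mx 1 = 0 :> 'M[R]_(d, 1).
    by apply/matrixP => i j; rewrite !mxE addNr.
  rewrite det_ublock det1 mul1r; congr (\det _).
  by apply/matrixP => i j; rewrite !mxE big_ord1 !mxE mulN1r addrC.
rewrite -!detV.
have ss' : size s' == d.+1 by rewrite -(perm_size ps) ss.
have [p sp] := tuple_permP (ps : perm_eq s (Tuple ss')).
have -> : V s = row_perm p (V s' : 'M[R]_(d.+1)).
  apply/matrixP => i j; rewrite !mxE sp /=.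
  by rewrite (nth_map i) ?size_enum_ord // nth_ord_enum (tnth_nth 0).
by rewrite row_permE det_mulmx det_perm exprMn sqrr_sign mul1r.
Qed.

Section OneSimplex.
Variables (R : realType) (d : nat) (M : mesh R d).
Local Notation E := 'rV[R]_d.
Implicit Types (A S T : {set node M}) (a b p q : node M) (x y : E).

Definition nondegenerate_simplex T := #|T| = d.+1 /\ row_free (edge_mx d (vertex T)).

Lemma edge_mx_mulE T (a0 : node M) x i : #|T| = d.+1 ->
  (edge_mx d (vertex T) *m x^T) i 0 =
  dotv x (pos (nth a0 (enum T) i.+1) - pos (nth a0 (enum T) 0)).
Proof.
move=> cT; rewrite mxE; apply: eq_bigr => j _.
by rewrite mulrC !mxE !(vertexE a0) ?cT // ltnS.
Qed.

Lemma nodal_gradient T (l : node M -> R) : nondegenerate_simplex T ->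
  exists x, forall p q, p \in T -> q \in T ->
    dotv x (pos p - pos q) = l p - l q.
Proof.
move=> [cT]; rewrite row_free_unit => Ju.
have /card_gt0P[a0 a0T] : (0 < #|T|)%N by rewrite cT.
pose e i := nth a0 (enum T) i.
pose c : 'cV[R]_d := \col_i (l (e i.+1) - l (e 0)).
exists (invmx (edge_mx d (vertex T)) *m c)^T; set x := _^T.
suff h p : p \in T -> dotv x (pos p - pos (e 0)) = l p - l (e 0).
  have subrBB (V : zmodType) (u v w : V) : u - v = u - w - (v - w).
    by rewrite opprB addrA subrK.
  move=> p q pT qT.
  by rewrite (subrBB _ _ _ (pos (e 0%N))) dotvBr !h // -subrBB.
move=> pT; have : (index p (enum T) < d.+1)%N.
  by rewrite -cT cardE index_mem mem_enum.
have : e (index p (enum T)) = p by rewrite /e nth_index ?mem_enum.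
case: (index p (enum T)) => [<-|j <- jd].
  by rewrite !subrr dotv0r.
rewrite -(edge_mx_mulE a0 _ (Ordinal (jd : (j < d)%N))) //.
by rewrite /x trmxK mulKVmx // mxE.
Qed.

Lemma nodal_gradient_unique T x : nondegenerate_simplex T ->
  (forall p q, p \in T -> q \in T -> dotv x (pos p - pos q) = 0) -> x = 0.
Proof.
move=> [cT free] x0.
have /card_gt0P[a0 a0T] : (0 < #|T|)%N by rewrite cT.
have eT i : (i < d.+1)%N -> nth a0 (enum T) i \in T.
  by move=> id; rewrite -mem_enum mem_nth // -cardE cT.
rewrite row_free_unit in free.
apply: trmx_inj; rewrite -[LHS](mulKmx free) -[x^T](mulKmx free).
have -> : edge_mx d (vertex T) *m x^T = 0.
  by apply/colP => i; rewrite (edge_mx_mulE a0) // x0 ?mxE ?eT // ltnS.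
by rewrite !mulmx0 trmx0.
Qed.

Lemma nodal_gradient_unique_at T b x : nondegenerate_simplex T ->
  (forall p, p \in T -> dotv x (pos p - pos b) = 0) -> x = 0.
Proof.
move=> hT h; apply: (nodal_gradient_unique hT) => p q pT qT.
have -> : pos p - pos q = pos p - pos b - (pos q - pos b).
  by rewrite opprB addrA subrK.
by rewrite dotvBr !h // subrr.
Qed.

(* The gradient of the barycentric coordinate of [T] belonging to [a]. *)
Definition bgrad T a : E := xget 0 [set x | forall p q, p \in T -> q \in T ->
  dotv x (pos p - pos q) = (p == a)%:R - (q == a)%:R].

(** Normalised by the value 1/(d+1) at the barycenter, which spares the choice of a reference
    vertex. *)
Definition bcoord T a x : R := d.+1%:R^-1 + dotv (bgrad T a) (x - bary T).

Section Nondegenerate.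
Variables (T : {set node M}) (hT : nondegenerate_simplex T).

Let cT : #|T| = d.+1. Proof. by case: hT. Qed.
Let dS : d.+1%:R != 0 :> R. Proof. by rewrite pnatr_eq0. Qed.

Lemma bgradP a p q : p \in T -> q \in T ->
  dotv (bgrad T a) (pos p - pos q) = (p == a)%:R - (q == a)%:R.
Proof.
rewrite /bgrad; case: xgetP => [x -> h|no]; first exact: h.
have [x hx] := nodal_gradient (fun p => (p == a)%:R) hT.
by case: (no x).
Qed.

Lemma sum_pred1 (F : node M -> R) a : a \in T ->
  \sum_(p in T) F p * (p == a)%:R = F a.
Proof.
move=> aT; rewrite (bigD1 a) //= eqxx mulr1 big1 ?addr0 // => p /andP[_ pa].
by rewrite (negbTE pa) mulr0.
Qed.

Lemma nodal_gradientE x (l : node M -> R) :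
  (forall p q, p \in T -> q \in T -> dotv x (pos p - pos q) = l p - l q) ->
  x = \sum_(a in T) l a *: bgrad T a.
Proof.
move=> h; apply/eqP; rewrite -subr_eq0; apply/eqP.
apply: (nodal_gradient_unique hT) => // p q pT qT.
rewrite dotvBl h // dotv_suml.
under eq_bigr => a _ do rewrite dotvZl bgradP // mulrBr !(eq_sym _ a).
by rewrite sumrB !sum_pred1 ?subrr.
Qed.

(** A vector is the gradient of the linear form it represents, whose nodal values are its products
    with the vertices. *)
Lemma gradientE x : x = \sum_(a in T) dotv x (pos a) *: bgrad T a.
Proof. by apply: nodal_gradientE => p q _ _; rewrite dotvBr. Qed.

Lemma sum_bgrad : \sum_(a in T) bgrad T a = 0.
Proof.
rewrite [RHS](@nodal_gradientE _ (fun=> 1)).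
  by apply: eq_bigr => a _; rewrite scale1r.
by move=> p q _ _; rewrite dotv0l subrr.
Qed.

Lemma sum_bcoord x : \sum_(a in T) bcoord T a x = 1.
Proof.
rewrite big_split /= -dotv_suml sum_bgrad dotv0l addr0 sumr_const cT.
by rewrite -[LHS]mulr_natr mulVf.
Qed.

Lemma bcoordE x : \sum_(a in T) bcoord T a x *: pos a = x.
Proof.
suff h w : dotv (\sum_(a in T) bcoord T a x *: pos a) w = dotv x w.
  by apply/rowP => i; rewrite -!dotv_delta h.
rewrite dotv_suml.
under eq_bigr => a _ do rewrite dotvZl mulrDl.
rewrite big_split /= -mulr_sumr -cT -(dotv_bary _ w).
have -> : \sum_(a in T) dotv (bgrad T a) (x - bary T) * dotv (pos a) w =
    dotv w (x - bary T).
  rewrite [in RHS](gradientE w) dotv_suml; apply: eq_bigr => a _.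
  by rewrite dotvZl mulrC (dotvC w).
by rewrite dotvBr !(dotvC w) addrC subrK.
Qed.

Lemma bcoord_pos a p : a \in T -> p \in T -> bcoord T a (pos p) = (p == a)%:R.
Proof.
move=> aT pT; rewrite /bcoord.
have -> : pos p - bary T = d.+1%:R^-1 *: \sum_(q in T) (pos p - pos q).
  rewrite sumrB sumr_const cT scalerBr -[pos p *+ _]scaler_nat scalerA.
  by rewrite mulVf // scale1r /bary cT.
rewrite dotvZr dotv_sumr.
under eq_bigr => q qT do rewrite bgradP // -(mul1r (q == a)%:R).
rewrite sumrB sumr_const cT (sum_pred1 (fun=> 1)) // -[X in _ * (X - _)]mulr_natr.
by rewrite mulrBr mulrCA mulr1 mulVf // mulr1 addrCA subrr addr0.
Qed.

Lemma bcoord_sum A (l : node M -> R) a : A \subset T -> a \in T ->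
  \sum_(p in A) l p = 1 ->
  bcoord T a (\sum_(p in A) l p *: pos p) = if a \in A then l a else 0.
Proof.
move=> /fintype.subsetP AT aT l1.
transitivity (\sum_(p in A) l p * bcoord T a (pos p)).
  rewrite /bcoord -[_^-1 in LHS]mul1r -l1 mulr_suml dotvBr dotv_sumr.
  rewrite -[dotv _ (bary T) in LHS]mul1r -[in X in _ + (_ - X)]l1.
  rewrite [in X in _ + (_ - X)]mulr_suml -sumrB -big_split /=.
  by apply: eq_bigr => p _; rewrite dotvZr dotvBr mulrDr mulrBr.
under eq_bigr => p pA do rewrite (bcoord_pos aT (AT _ pA)).
case: ifPn => [aA|aA].
  rewrite (bigD1 a) //= eqxx mulr1 big1 ?addr0 // => p /andP[_ pa].
  by rewrite (negbTE pa) mulr0.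
rewrite big1 // => p pA; have [pa|] := eqVneq p a; last by rewrite mulr0.
by rewrite -pa pA in aA.
Qed.

Lemma bcoord_line a x w e :
  bcoord T a (x + e *: w) = bcoord T a x + e * dotv (bgrad T a) w.
Proof. by rewrite /bcoord !dotvBr dotvDr dotvZr; ring. Qed.

Lemma hullP x : hull T x <-> forall a, a \in T -> 0 <= bcoord T a x.
Proof.
split=> [[l [l0 l1 ->]] a aT|h]; first by rewrite bcoord_sum // aT l0.
by exists (fun a => bcoord T a x); split; rewrite ?sum_bcoord ?bcoordE.
Qed.

Lemma bary_bcoord A a : A \subset T -> (0 < #|A|)%N -> a \in T ->
  bcoord T a (bary A) = if a \in A then #|A|%:R^-1 else 0.
Proof.
move=> AT A0 aT; rewrite /bary scaler_sumr (bcoord_sum (l := fun=> _)) //.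
by rewrite sumr_const -[LHS]mulr_natr mulVf // pnatr_eq0 -lt0n.
Qed.

Lemma bgrad_neq0 a b : a \in T -> b \in T -> a != b -> bgrad T a != 0.
Proof.
move=> aT bT ab; apply/eqP => g0.
have := @bgradP a a b aT bT; rewrite g0 dotv0l eqxx eq_sym (negbTE ab) subr0.
by move/esym/eqP; rewrite oner_eq0.
Qed.

End Nondegenerate.
End OneSimplex.

(** * Normals and volumes of facets *)

Section FacetsOfOneSimplex.
Variables (R : realType) (d : nat) (M : mesh R d).
Local Notation E := 'rV[R]_d.
Variables (T : {set node M}) (hd : (0 < d)%N) (hT : nondegenerate_simplex T).

Let cT : #|T| = d.+1. Proof. by case: hT. Qed.

Lemma card_facet a : a \in T -> #|T :\ a| = d.
Proof. by move=> aT; have := cardsD1 a T; rewrite aT cT => -[]. Qed.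

Lemma facet_witness a : a \in T -> exists2 b, b \in T & b != a.
Proof.
move=> aT; have : (0 < #|T :\ a|)%N by rewrite card_facet.
by case/card_gt0P => b; rewrite !inE => /andP[ba bT]; exists b.
Qed.

Lemma enorm_bgrad_gt0 a : a \in T -> 0 < enorm (bgrad T a).
Proof.
move=> aT; have [b bT ba] := facet_witness aT.
by rewrite enorm_gt0 (bgrad_neq0 hT aT bT) // eq_sym.
Qed.

(** Vanishing along the facet leaves only multiples of the gradient; the unit length fixes the
    modulus and the last condition the sign. Existence is checked as well, since the choice operator
    would otherwise return 0. *)
Lemma outer_normalE a : a \in T ->
  outer_normal T (T :\ a) = - (enorm (bgrad T a))^-1 *: bgrad T a.
Proof.
move=> aT; have g0 := enorm_bgrad_gt0 aT.
have [b bT ba] := facet_witness aT.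
have diffE p : (p \in T :\: (T :\ a)) = (p == a).
  by rewrite !inE negb_and negbK; case: eqP => [->|_] //=; rewrite andNb.
rewrite /outer_normal; case: xgetP => [n _ [n1 n0 nneg]|no].
  pose h := - dotv n (pos a - pos b).
  have h0 : 0 < h by rewrite oppr_gt0 nneg ?diffE // !inE ba.
  have nE : n = - h *: bgrad T a.
    apply/eqP; rewrite -subr_eq0; apply/eqP.
    have key p : p \in T -> dotv (n - - h *: bgrad T a) (pos p - pos b) = 0.
      move=> pT; rewrite dotvBl dotvZl (bgradP hT) // (negbTE ba) subr0.
      have [->|pa] := eqVneq p a; first by rewrite mulr1 opprK addrN.
      by rewrite mulr0 subr0 n0 // !inE ?pa ?ba.
    exact: (nodal_gradient_unique_at hT key).
  move: n1; rewrite nE enormZ normrN gtr0_norm // => /eqP.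
  rewrite -[1](mulVf (lt0r_neq0 g0)) (inj_eq (mulIf (lt0r_neq0 g0))) => /eqP ->.
  by [].
exfalso; apply: (no (- (enorm (bgrad T a))^-1 *: bgrad T a)); split.
- by rewrite enormZ normrN gtr0_norm ?invr_gt0 // mulVf // gt_eqF.
- move=> p q; rewrite !inE => /andP[pa pT] /andP[qa qT].
  by rewrite dotvZl (bgradP hT) // (negbTE pa) (negbTE qa) subrr mulr0.
- move=> p q; rewrite diffE => /eqP ->; rewrite !inE => /andP[qa qT].
  rewrite dotvZl (bgradP hT) // eqxx (negbTE qa) subr0 mulr1.
  by rewrite oppr_lt0 invr_gt0.
Qed.

Lemma vol_gt0 : 0 < vol T.
Proof.
rewrite (volE cT) divr_gt0 ?ltr0n ?fact_gt0 // sqrtr_gt0.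
rewrite det_mulmx det_tr -expr2 exprn_even_gt0 //=.
by case: hT => _; rewrite row_free_unit unitmxE unitfE.
Qed.

End FacetsOfOneSimplex.

(** Put either the gradient g or an edge w towards [a] on top of the facet edges J, giving [J1] and
    [J2]. Since J g^T = 0 and w.g = 1, block determinants give det J1^2 = |g|^2 G and det J2 * det
    J1 = G, with G the Gram determinant of the facet. Squaring the second and cancelling G leaves
    the claim, because det J2^2 is the squared determinant of the edges of [T]. *)
Lemma gram_facet (R : realType) (k : nat) (M : mesh R k.+1) (T : {set node M}) a :
  nondegenerate_simplex T -> a \in T ->
  let J := edge_mx k (vertex (T :\ a)) in
  \det (J *m J^T) = \det (edge_mx k.+1 (vertex T)) ^+ 2 * enorm (bgrad T a) ^+ 2.
Proof.
move=> hT aT J.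
have cS := card_facet hT aT.
have [b0 [rest Se]] : exists b0 rest, enum (T :\ a) = b0 :: rest.
  move: cS; rewrite cardE; case: (enum _) => // b0 rest _; by exists b0, rest.
have memS p : p \in b0 :: rest -> p \in T :\ a by rewrite -Se mem_enum.
have sz : size rest = k by move: cS; rewrite cardE Se => -[].
set g := bgrad T a; pose w : 'rV[R]_k.+1 := pos a - pos b0.
have b0S : b0 \in T :\ a by apply: memS; rewrite inE eqxx.
have [b0a b0T] : b0 != a /\ b0 \in T by move: b0S; rewrite !inE => /andP.
have wg : dotv w g = 1.
  by rewrite dotvC (bgradP hT) // eqxx (negbTE b0a) subr0.
have Jg : J *m g^T = 0.
  apply/colP => i; rewrite !mxE.
  rewrite -[RHS](_ : dotv (vertex (T :\ a) i.+1 - vertex (T :\ a) 0) g = 0).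
    by apply: eq_bigr => j _; rewrite !mxE.
  have iS j : (j < k.+1)%N -> nth b0 (enum (T :\ a)) j \in T :\ a.
    by move=> jk; rewrite -mem_enum mem_nth // -cardE cS.
  rewrite !(vertexE b0) ?cS ?ltnS // dotvC.
  have /setD1P[p1 p2] := iS i.+1 (ltn_ord i).
  have /setD1P[q1 q2] := iS 0%N isT.
  by rewrite (bgradP hT) // (negbTE p1) (negbTE q1) subrr.
have gJ : g *m J^T = 0 by apply: trmx_inj; rewrite trmx_mul trmxK Jg trmx0.
pose J1 : 'M[R]_(1 + k) := col_mx g J.
pose J2 : 'M[R]_(1 + k) := col_mx w J.
set G := \det (J *m J^T).
have det11 (X : 'M[R]_1) : \det X = X 0 0.
  by rewrite [X]mx11_scalar det_scalar1 -mx11_scalar.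
have d1 : \det J1 ^+ 2 = enorm g ^+ 2 * G.
  rewrite expr2 -[X in _ * X]det_tr -det_mulmx /J1 tr_col_mx mul_col_row Jg gJ.
  by rewrite det_lblock det11 -dotvE sqr_enorm.
have d12 : \det J2 * \det J1 = G.
  rewrite -[X in _ * X]det_tr -det_mulmx /J1 /J2 tr_col_mx mul_col_row Jg.
  by rewrite det_ublock det11 -dotvE wg mul1r.
have d2 : \det J2 ^+ 2 = \det (edge_mx k.+1 (vertex T)) ^+ 2.
  (* [J2] is the edge matrix of [T] for the vertex order b0, a, rest, so only a reordering separates
     it from the one given by [enum T]. *)
  have -> : J2 = edge_mx k.+1 (nth 0 [seq pos p | p <- b0 :: a :: rest]).
    apply/matrixP => i j; rewrite [RHS]mxE.
    case: (split_ordP (m := 1) (n := k) i) => i' ->.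
      by rewrite col_mxEu (ord1 i').
    rewrite col_mxEd !mxE !(vertexE b0) ?cS ?ltnS ?(ltnW (ltn_ord i')) //.
    by rewrite Se /= (nth_map b0) ?sz /= ?add0n.
  apply: sqr_det_edge_mx_perm; first by rewrite size_map /= sz.
  apply/perm_map/uniq_perm; last 1 first.
  - move=> p; rewrite mem_enum.
    have := mem_enum (mem (T :\ a)) p; rewrite Se !inE.
    by have [->|] := eqVneq p a; rewrite ?aT ?orbT //= => _ <-.
  - have := enum_uniq (mem (T :\ a)); rewrite Se /= => /andP[b0r ->].
    rewrite inE negb_or b0a b0r !andbT /=; apply/negP => ar.
    by have := memS a; rewrite in_cons ar orbT in_setD1 eqxx => /(_ isT).
  - exact: enum_uniq.
(* A kernel vector of [J1^T] is orthogonal to the facet, hence a multiple of g; being orthogonal to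
   g as well, it vanishes. *)
have G0 : G != 0.
  apply/eqP => G0; have : \det J1^T == 0.
    by rewrite det_tr -sqrf_eq0 d1 G0 mulr0.
  case/det0P => v v0 vJ1.
  have : v *m J1^T = row_mx (v *m g^T) (v *m J^T).
    by rewrite /J1 tr_col_mx mul_mx_row.
  rewrite vJ1 -row_mx0 => /esym/eq_row_mx[vg vJ].
  have h p : p \in T -> dotv (v - dotv v w *: g) (pos p - pos b0) = 0.
    move=> pT; rewrite dotvBl dotvZl (bgradP hT) // (negbTE b0a) subr0.
    have [->|pa] := eqVneq p a; first by rewrite mulr1 subrr.
    rewrite mulr0 subr0.
    have : p \in b0 :: rest by rewrite -Se mem_enum !inE pa pT.
    rewrite inE => /predU1P[->|pr]; first by rewrite subrr dotv0r.
    have ik : (index p rest < k)%N by rewrite (leq_trans _ (eq_leq sz)) ?index_mem.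
    move/rowP: vJ => /(_ (Ordinal ik)); rewrite mxE [RHS]mxE => <-.
    apply: eq_bigr => j _; rewrite !mxE !(vertexE b0) ?cS ?ltnS //.
    by rewrite Se /= nth_index.
  have vE : v = dotv v w *: g.
    apply/eqP; rewrite -subr_eq0; apply/eqP.
    exact: (nodal_gradient_unique_at hT h).
  move/eqP: v0; apply; rewrite vE.
  have := dotvE v g; rewrite vg mxE {1}vE dotvZl => /eqP.
  by rewrite mulf_eq0 dotv_eq0 => /orP[/eqP ->|/eqP ->]; rewrite ?scale0r ?scaler0.
apply: (mulIf G0); rewrite -mulrA -d1 -d2 -exprMn d12.
by rewrite expr2.
Qed.

(** Square root of [gram_facet]; the factor d is the quotient of the factorials in the two simplex
    volumes. *)
Lemma vol_facet (R : realType) (d : nat) (M : mesh R d) (T : {set node M}) a :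
  (0 < d)%N -> nondegenerate_simplex T -> a \in T ->
  vol (T :\ a) = d%:R * vol T * enorm (bgrad T a).
Proof.
case: d M T a => // k M T a _ hT aT.
rewrite (volE (card_facet hT aT)) (volE (proj1 hT)) gram_facet //.
rewrite -exprMn sqrtr_sqr normrM (ger0_norm (enorm_ge0 _)).
rewrite det_mulmx det_tr -expr2 sqrtr_sqr.
have : k`!%:R != 0 :> R by rewrite pnatr_eq0 -lt0n fact_gt0.
have : k.+1%:R != 0 :> R by rewrite pnatr_eq0.
rewrite factS natrM; move: (k.+1%:R) (k`!%:R) => x y x0 y0.
by field; rewrite ?x0 ?y0.
Qed.

(** * Affine functions and fields, and Green's formula on one element *)

Section AffineFunctions.
Variables (R : realType) (d : nat).
Local Notation E := 'rV[R]_d.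
Implicit Types (f : E -> R) (w : E -> E).

Lemma poly_deg_le1P f :
  poly_deg_le 1 f <-> exists c b, forall x, f x = c + dotv x b.
Proof.
split=> [[c [q [/choice[b qb] fE]]]|[c [b fE]]].
  exists c, (\row_i b i) => x; rewrite fE; congr (_ + _).
  by apply: eq_bigr => i _; rewrite qb mxE.
by exists c, (fun i _ => b 0 i); split=> // i; exists (b 0 i).
Qed.

Lemma poly_deg_le1_lin (f g : E -> R) t : poly_deg_le 1 f -> poly_deg_le 1 g ->
  poly_deg_le 1 (fun x => f x + t * g x).
Proof.
move=> /poly_deg_le1P[c [b fE]] /poly_deg_le1P[c' [b' gE]].
apply/poly_deg_le1P; exists (c + t * c'), (b + t *: b') => x.
by rewrite fE gE dotvDr dotvZr; ring.
Qed.

Lemma partial_affine f c b i x : (forall y, f y = c + dotv y b) ->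
  partial f i x = b 0 i.
Proof.
move=> fE; rewrite /partial.
have -> : (fun t : R => f (x + t *: delta_mx 0 i)) =
    (horner ((b 0 i) *: 'X + (c + dotv x b)%:P)).
  apply: funext => t; rewrite fE dotvDl dotvZl (dotvC (delta_mx 0 i)) dotv_delta.
  by rewrite hornerD hornerZ hornerX hornerC; ring.
rewrite -derivE derivD derivZ derivX derivC addr0 hornerZ hornerC mulr1.
by [].
Qed.

Lemma grad_affine f c b x : (forall y, f y = c + dotv y b) -> grad f x = b.
Proof. by move=> fE; apply/rowP => i; rewrite mxE (partial_affine _ _ fE). Qed.

Lemma affine_vectorP w : (forall i, poly_deg_le 1 (fun x => w x 0 i)) <->
  exists c A, forall x, w x = c + x *m A.
Proof.
split=> [h|[c [A wE]] i]; last first.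
  apply/poly_deg_le1P; exists (c 0 i), (col i A)^T => x.
  by rewrite wE !mxE; congr (_ + _); apply: eq_bigr => j _; rewrite !mxE.
have /choice[cb cbE] : forall i, exists cb : R * E,
    forall x, w x 0 i = cb.1 + dotv x cb.2.
  by move=> i; have /poly_deg_le1P[c [b cb]] := h i; exists (c, b).
exists (\row_i (cb i).1), (\matrix_(j, i) (cb i).2 0 j) => x.
apply/rowP => i; rewrite cbE !mxE; congr (_ + _).
by apply: eq_bigr => j _; rewrite !mxE.
Qed.

Lemma divg_affine w c A x : (forall y, w y = c + y *m A) -> divg w x = \tr A.
Proof.
move=> wE; apply: eq_bigr => i _.
rewrite (@partial_affine _ (c 0 i) (col i A)^T) ?mxE // => y.
by rewrite wE !mxE; congr (_ + _); apply: eq_bigr => j _; rewrite !mxE.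
Qed.

End AffineFunctions.

Section LocalGreen.
Variables (R : realType) (d : nat) (M : mesh R d).
Local Notation E := 'rV[R]_d.
Implicit Types (T S : {set node M}).

Lemma affine_bary S (f : E -> R) c b : (0 < #|S|)%N ->
  (forall x, f x = c + dotv x b) ->
  f (bary S) = #|S|%:R^-1 * \sum_(a in S) f (pos a).
Proof.
move=> S0 fE; under eq_bigr do rewrite fE.
rewrite big_split /= sumr_const -[c *+ _]mulr_natr mulrDr mulrCA mulVf ?mulr1.
  by rewrite fE dotv_bary.
by rewrite pnatr_eq0 -lt0n.
Qed.

Lemma pos_in_hull S a : a \in S -> hull S (pos a).
Proof.
move=> aS; exists (fun p => (p == a)%:R); split=> [p _||].
- exact: ler0n.
- by rewrite (bigD1 a) //= eqxx big1 ?addr0 // => p /andP[_ /negbTE ->].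
- rewrite (bigD1 a) //= eqxx scale1r big1 ?addr0 // => p /andP[_ /negbTE ->].
  by rewrite scale0r.
Qed.

(** The constant normal component on the facet opposite [a] fixes the product of [bgrad T a] with
    [w] at every vertex except [a]; there it follows because the gradients sum to zero. Hence all
    values of [w] are expressed by the numbers [K a], and both sides become the same sum of nodal
    values. *)
Lemma local_green T (v : E -> R) c b (w : E -> E) w0
    (A : 'M[R]_d) (C : node M -> R) :
  (0 < d)%N -> nondegenerate_simplex T ->
  (forall x, v x = c + dotv x b) -> (forall x, w x = w0 + x *m A) ->
  (forall a x, a \in T -> hull (T :\ a) x ->
    dotv (w x) (outer_normal T (T :\ a)) = C a) ->
  vol T * (dotv b (w (bary T)) + v (bary T) * \tr A) =
  \sum_(a in T) vol (T :\ a) * (v (bary (T :\ a)) * C a).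
Proof.
move=> hd hT vE wE wC.
have [cT _] := hT; have T0 : (0 < #|T|)%N by rewrite cT.
pose g a := bgrad T a; pose Y (a q : node M) := dotv (g a) (w (pos q)).
(* [K a] is the product of the gradient with [w] on the facet opposite [a]; the minus sign appears
   because the outer normal points against the gradient. *)
pose K a := - (enorm (g a) * C a); pose Ks := \sum_(a in T) K a.
have YK a q : a \in T -> q \in T -> q != a -> Y a q = K a.
  move=> aT qT qa; rewrite /K -(wC a (pos q) aT); last first.
    by apply: pos_in_hull; rewrite !inE qa.
  rewrite outer_normalE // dotvZr mulNr mulrN opprK dotvC mulVKf //.
  exact/lt0r_neq0/enorm_bgrad_gt0.
have YE a q : a \in T -> q \in T -> Y a q = K a - (a == q)%:R * Ks.
  move=> aT qT; have [aq|aq] := eqVneq a q; last first.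
    by rewrite mul0r subr0 YK // eq_sym.
  rewrite mul1r -aq /Ks (bigD1 a) //= opprD addNKr.
  have : \sum_(p in T) Y p a = 0 by rewrite -dotv_suml sum_bgrad // dotv0l.
  rewrite (bigD1 a) //= => /eqP; rewrite addr_eq0 => /eqP ->; congr (- _).
  by apply: eq_bigr => p /andP[pT pa]; rewrite YK // eq_sym.
(* Matrix form of [gradientE]; it allows the trace of [A] to be read off from vertex values. *)
have gI : \sum_(a in T) (pos a)^T *m g a = 1%:M.
  apply/row_matrixP => i; rewrite !rowE; set e := delta_mx 0 i.
  rewrite mulmx1 mulmx_sumr [RHS](gradientE hT); apply: eq_bigr => a _.
  by rewrite mulmxA dotvE -mul_scalar_mx -mx11_scalar.
have trA : \tr A = - d%:R * Ks.
  have -> : \tr A = \sum_(a in T) dotv (g a) (pos a *m A).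
    rewrite -mxtrace_tr -[A^T]mul1mx -gI mulmx_suml raddf_sum /=.
    apply: eq_bigr => a _; rewrite -mulmxA mxtrace_mulC dotvE trmx_mul mulmxA.
    by rewrite [X in \tr X]mx11_scalar mxtrace_scalar mulr1n.
  transitivity (\sum_(a in T) (K a - Ks)).
    transitivity (\sum_(a in T) (Y a a - dotv (g a) w0)).
      by apply: eq_bigr => a _; rewrite /Y wE dotvDr addrAC subrr add0r.
    rewrite sumrB -dotv_suml sum_bgrad // dotv0l subr0.
    by apply: eq_bigr => a aT; rewrite YE // eqxx mul1r.
  by rewrite sumrB sumr_const cT -/Ks -[Ks *+ _]mulr_natl -natr1; ring.
have d1 : d.+1%:R != 0 :> R by rewrite pnatr_eq0.
have d0 : d%:R != 0 :> R by rewrite pnatr_eq0 -lt0n.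
pose V := \sum_(a in T) v (pos a).
have vT : v (bary T) = d.+1%:R^-1 * V by rewrite (affine_bary T0 vE) cT.
have wT a : a \in T -> dotv (g a) (w (bary T)) = K a - d.+1%:R^-1 * Ks.
  move=> aT.
  have -> : dotv (g a) (w (bary T)) = d.+1%:R^-1 * \sum_(q in T) Y a q.
    rewrite -cT /Y -(affine_bary (f := fun x => dotv (g a) (w x))
      (c := dotv (g a) w0) (b := g a *m A^T)) // => x.
    by rewrite wE dotvDr; congr (_ + _); rewrite [RHS]dotvC !dotvE trmx_mul mulmxA.
  under eq_bigr => q qT do rewrite YE // mulrC eq_sym.
  rewrite sumrB sumr_const cT -mulr_sumr -[K a *+ _]mulr_natl.
  have -> : \sum_(q in T) (q == a)%:R = 1 :> R.
    rewrite (bigD1 a) //= eqxx big1 ?addr0 // => q /andP[_ /negbTE ->].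
    by [].
  by rewrite mulr1 mulrBr mulKf.
have vS a : a \in T -> v (bary (T :\ a)) = d%:R^-1 * (V - v (pos a)).
  move=> aT; rewrite (affine_bary _ vE) ?card_facet //; congr (_ * _).
  rewrite /V [in RHS](bigD1 a) //= addrAC subrr add0r.
  by apply: eq_bigl => q; rewrite !inE andbC.
have bE : dotv b (w (bary T)) = \sum_(a in T) v (pos a) * (K a - d.+1%:R^-1 * Ks).
  have {1}-> : b = \sum_(a in T) v (pos a) *: g a.
    apply: nodal_gradientE => // p q _ _.
    by rewrite !vE dotvBr !(dotvC b); ring.
  rewrite dotv_suml; apply: eq_bigr => a aT; by rewrite dotvZl wT.
(* The common form of both sides. On the boundary side the factor d of [vol_facet] cancels the 1/d
   of the facet average of [v]. *)
transitivity (vol T * \sum_(a in T) (v (pos a) - V) * K a).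
  congr (_ * _); rewrite bE vT trA.
  under [in LHS]eq_bigr do rewrite mulrBr.
  under [in RHS]eq_bigr do rewrite mulrBl.
  rewrite !sumrB -mulr_suml -mulr_sumr -/V -/Ks -natr1.
  by move: d1; rewrite -natr1 => d1; field.
rewrite mulr_sumr; apply: eq_bigr => a aT.
rewrite vol_facet // vS // /K -/(g a).
by field.
Qed.

End LocalGreen.

(** * Sides of a triangulation *)

Section NearZeroRight.
Variable R : realType.

(** Membership in open sets and strict inequalities are both stated for all small positive
    parameters of a ray, so that finitely many of them can be intersected. *)
Lemma near_ray (d : nat) (U : set 'rV[R]_d) x w : open U -> U x ->
  \forall e \near (0 : R)^'+, U (x + e *: w).
Proof.
move=> oU Ux; have : (fun e : R => x + e *: w) e @[e --> (0 : R)^'+] --> x.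
  rewrite -[X in _ --> X](_ : x + 0 *: w = x); last by rewrite scale0r addr0.
  apply: cvgD; first exact: cvg_cst.
  apply: cvgZ; last exact: cvg_cst.
  by apply: cvg_at_right_filter; exact: cvg_id.
by move=> h; exact: (h _ (open_nbhs_nbhs (conj oU Ux))).
Qed.

Lemma near_affine_gt0 (s t : R) : 0 < s -> \forall e \near (0 : R)^'+, 0 < s + e * t.
Proof.
move=> s0; have : (fun e : R => s + e * t) e @[e --> (0 : R)^'+] --> s.
  rewrite -[X in _ --> X](_ : s + 0 * t = s); last by rewrite mul0r addr0.
  apply: cvgD; first exact: cvg_cst.
  apply: cvgM; last exact: cvg_cst.
  by apply: cvg_at_right_filter; exact: cvg_id.
by move=> h; exact: (h _ (lt_nbhsr s0)).
Qed.

End NearZeroRight.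

Section MeshTopology.
Variables (R : realType) (d : nat) (Om : set 'rV[R]_d) (M : mesh R d).
Local Notation E := 'rV[R]_d.
Hypotheses (hd : (0 < d)%N) (hM : triangulation M Om).
Implicit Types (S T : {set node M}).

Lemma elems_nondegenerate T : T \in elems M -> nondegenerate_simplex T.
Proof. by case: hM => _ h _ _ /h. Qed.

Lemma hull_closure T x : T \in elems M -> hull T x -> closure Om x.
Proof. by case: hM => _ _ _ -> TM Tx; exists T. Qed.

Lemma card_sides S : S \in sides M -> #|S| = d.
Proof. by rewrite inE => /andP[/eqP]. Qed.

Lemma side_opposite S T : #|S| = d -> T \in elems M -> S \subset T ->
  exists2 a, a \in T & S = T :\ a.
Proof.
move=> cS TM ST; have [cT _] := elems_nondegenerate TM.
have : #|T :\: S| = 1%N.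
  by have := cardsID S T; rewrite (finset.setIidPr ST) cS cT -addn1 => /addnI.
move=> /eqP/cards1P[a Da].
have : a \in T :\: S by rewrite Da set11.
rewrite inE => /andP[aS aT]; exists a => //.
apply/eqP; rewrite eqEcard cS card_facet //; last exact: elems_nondegenerate.
rewrite leqnn andbT; apply/fintype.subsetP => b bS.
rewrite !inE (fintype.subsetP ST _ bS) andbT.
by apply: contraNneq aS => <-.
Qed.

Lemma facet_side T a : T \in elems M -> a \in T -> T :\ a \in sides M.
Proof.
move=> TM aT; rewrite inE card_facet // ?eqxx /=; last exact: elems_nondegenerate.
by apply/existsP; exists T; rewrite TM subD1set.
Qed.

Lemma bary_in_hull S : (0 < #|S|)%N -> hull S (bary S).
Proof.
move=> S0; exists (fun=> #|S|%:R^-1); split=> [a _||].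
- by rewrite invr_ge0 ler0n.
- by rewrite sumr_const -[LHS]mulr_natr mulVf // pnatr_eq0 -lt0n.
- by rewrite /bary scaler_sumr.
Qed.

Lemma subset_hull S T : S \subset T -> hull S `<=` hull T.
Proof.
move=> ST x [l [l0 l1 ->]].
have sumT (V : nmodType) (F : node M -> V) :
    \sum_(p in T) (if p \in S then F p else 0) = \sum_(p in S) F p.
  rewrite -big_mkcondr; apply: eq_bigl => p.
  by case: (boolP (p \in S)) => pS; rewrite ?andbF // (fintype.subsetP ST).
exists (fun p => if p \in S then l p else 0); split=> [a _||].
- by case: ifPn => // /l0.
- by rewrite sumT.
- rewrite -sumT; apply: eq_bigr => p _.
  by case: ifP; rewrite ?scale0r.
Qed.

Lemma bcoord_hull S T x a : T \in elems M -> S \subset T -> hull S x ->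
  a \in T -> a \notin S -> bcoord T a x = 0.
Proof.
move=> TM ST [l [_ l1 ->]] aT aS.
by rewrite (bcoord_sum (elems_nondegenerate TM)) // (negbTE aS).
Qed.

(** At the barycenter of the facet the coordinate of [a] is 0 and the others are 1/d. Small moves
    keep the latter positive, and the sign condition keeps the former from decreasing. *)
Lemma near_hull T a w : T \in elems M -> a \in T -> 0 <= dotv (bgrad T a) w ->
  \forall e \near (0 : R)^'+, hull T (bary (T :\ a) + e *: w).
Proof.
move=> TM aT gw; have hT := elems_nondegenerate TM.
have near_b b : \forall e \near (0 : R)^'+, b \in T ->
    0 <= bcoord T b (bary (T :\ a) + e *: w).
  have [bT|bT] := boolP (b \in T); last by near=> e.
  have [->|ba] := eqVneq b a.
    near=> e => _; rewrite bcoord_line bary_bcoord ?subD1set ?card_facet //.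
    by rewrite !inE eqxx add0r mulr_ge0 //; near: e; exact: nbhs_right_ge.
  have d0 : 0 < d%:R^-1 :> R by rewrite invr_gt0 ltr0n.
  have := near_affine_gt0 (dotv (bgrad T b) w) d0.
  apply: filterS => e he _.
  rewrite bcoord_line bary_bcoord ?subD1set ?card_facet //.
  by rewrite !inE ba bT; exact: ltW.
have := filter_forall (at_right_proper_filter 0) near_b.
by apply: filterS => e he; apply/(hullP hT).
Unshelve. all: by end_near.
Qed.

(* Otherwise both elements would contain a piece of the ray from the midpoint
   of the common side in the direction of the gradient. *)
Lemma opposite_gradients T T' a a' :
  T \in elems M -> T' \in elems M -> T != T' -> a \in T -> a' \in T' ->
  T :\ a = T' :\ a' ->
  exists2 k, 0 < k & bgrad T' a' = - k *: bgrad T a.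
Proof.
move=> TM T'M TT' aT aT' Saa'.
have hT := elems_nondegenerate TM; have hT' := elems_nondegenerate T'M.
have [b bT ba] := facet_witness hd hT aT.
have g0 := enorm_bgrad_gt0 hd hT aT.
(* Both gradients vanish along the common facet and are therefore parallel, with factor [k]; only
   its sign is at stake. *)
pose k := dotv (bgrad T' a') (pos a - pos b).
have bS : b \in T' :\ a' by rewrite -Saa' !inE ba.
have gE : bgrad T' a' = k *: bgrad T a.
  apply/eqP; rewrite -subr_eq0; apply/eqP.
  have key p : p \in T -> dotv (bgrad T' a' - k *: bgrad T a) (pos p - pos b) = 0.
    move=> pT; rewrite dotvBl dotvZl (bgradP hT) // (negbTE ba) subr0.
    have [->|pa] := eqVneq p a; first by rewrite mulr1 subrr.
    have : p \in T' :\ a' by rewrite -Saa' !inE pa.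
    rewrite !inE => /andP[pa' pT'].
    move: bS; rewrite !inE => /andP[ba' bT'].
    by rewrite (bgradP hT') // (negbTE pa') (negbTE ba') mulr0 !subr0.
  exact: (nodal_gradient_unique_at hT key).
have [k0|k0] := ltP k 0.
  by exists (- k); rewrite ?oppr_gt0 // opprK.
exfalso.
pose g := bgrad T a.
have gg : 0 < dotv g g by rewrite -sqr_enorm exprn_gt0.
have n1 := @near_hull T a g TM aT (ltW gg).
have n2 : \forall e \near (0 : R)^'+, hull T' (bary (T :\ a) + e *: g).
  by rewrite Saa'; apply: near_hull => //; rewrite gE dotvZl mulr_ge0 // ltW.
have TT'S : T :&: T' = T :\ a.
  apply/eqP; rewrite eq_sym eqEcard; apply/andP; split.
    by rewrite finset.subsetI subD1set Saa' subD1set.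
  rewrite card_facet // -ltnS.
  have [cT _] := hT; have [cT' _] := hT'.
  rewrite -cT proper_card // finset.properEneq finset.subsetIl andbT.
  apply: contraNneq TT' => /finset.setIidPl TsubT'.
  by rewrite eqEcard TsubT' cT cT' leqnn.
have : \forall e \near (0 : R)^'+, False.
  near=> e.
  have e0 : 0 < e by near: e; exact: nbhs_right_gt.
  have : hull (T :\ a) (bary (T :\ a) + e *: g).
    case: hM => _ _ /(_ T T' TM T'M) hI _; rewrite -TT'S -hI; split.
      by rewrite TT'S; near: e.
    by rewrite TT'S; near: e.
  move=> /(bcoord_hull TM (subD1set _ _))/(_ aT); rewrite !inE eqxx => /(_ isT).
  rewrite bcoord_line bary_bcoord ?subD1set ?card_facet //.
  rewrite !inE eqxx add0r => /eqP.
  by rewrite mulf_eq0 (gt_eqF e0) (gt_eqF gg).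
by move=> /filter_ex[].
Unshelve. all: by end_near.
Qed.

(** Three elements on one side would have pairwise opposite gradients, which is impossible: the
    opposite of the opposite is the same direction. *)
Lemma at_most_two_neighbours S T1 T2 T3 : S \in sides M ->
  T1 \in elems M -> T2 \in elems M -> T3 \in elems M ->
  S \subset T1 -> S \subset T2 -> S \subset T3 ->
  T1 != T2 -> T1 != T3 -> T2 = T3.
Proof.
move=> /card_sides cS M1 M2 M3 S1 S2 S3 T12 T13.
apply/eqP; apply/negPn/negP => T23.
have [a1 aT1 E1] := side_opposite cS M1 S1.
have [a2 aT2 E2] := side_opposite cS M2 S2.
have [a3 aT3 E3] := side_opposite cS M3 S3.
have [k k0 kE] := opposite_gradients M1 M2 T12 aT1 aT2 (etrans (esym E1) E2).
have [l l0 lE] := opposite_gradients M1 M3 T13 aT1 aT3 (etrans (esym E1) E3).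
have [m m0 mE] := opposite_gradients M2 M3 T23 aT2 aT3 (etrans (esym E2) E3).
move: mE; rewrite lE kE scalerA => /eqP.
rewrite -subr_eq0 -scalerBl scaler_eq0 mulrNN.
have := enorm_bgrad_gt0 hd (elems_nondegenerate M1) aT1.
rewrite enorm_gt0 => /negbTE ->; rewrite orbF.
have : 0 < l + m * k by rewrite addr_gt0 // mulr_gt0.
by rewrite -opprD oppr_eq0 => /gt_eqF ->.
Qed.

End MeshTopology.

(** * Which sides lie on the boundary of the domain *)

Section BoundarySides.
Variables (R : realType) (d : nat) (Om : set 'rV[R]_d) (M : mesh R d).
Local Notation E := 'rV[R]_d.
Hypotheses (hd : (0 < d)%N) (hM : triangulation M Om).
Hypothesis hOm : bounded_lipschitz_domain Om.
Implicit Types (S T : {set node M}).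

Let oOm : open Om. Proof. by case: hOm. Qed.

(* Above the Lipschitz graph there are no points of the closure. *)
Lemma bdry_escape x : bdry Om x -> exists w : E, 
  \forall e \near (0 : R)^'+, ~ closure Om (x + e *: w).
Proof.
move=> bx; have [_ _ _ _ /(_ _ bx)] := hOm.
move=> [nu [r [h [L [g [nu1 [r0 h0] _ _ [EOm Ebd]]]]]]]; exists nu.
have nunu : dotv nu nu = 1 by rewrite -sqr_enorm nu1 expr1n.
have heightE e : dotv (x + e *: nu - x) nu = e.
  by rewrite addrAC subrr add0r dotvZl nunu mulr1.
have projE e : x + e *: nu - x - e *: nu = 0.
  by rewrite (addrAC x) subrr add0r subrr.
(* The point [x] lies on the boundary and in its own cylinder, at height 0. *)
have g0 : g 0 = 0.
  have : (bdry Om `&` [set z | enorm (z - x - dotv (z - x) nu *: nu) < r /\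
      `|dotv (z - x) nu| < h]) x.
    by split=> //=; rewrite subrr dotv0l scale0r subrr enorm0 normr0.
  by rewrite Ebd /= subrr dotv0l scale0r subrr => -[_ <-].
near=> e.
have e0 : 0 < e by near: e; exact: nbhs_right_gt.
have eh : e < h by near: e; exact: nbhs_right_lt.
pose z := x + e *: nu.
have cz : enorm (z - x - dotv (z - x) nu *: nu) < r /\ `|dotv (z - x) nu| < h.
  by rewrite /z heightE projE enorm0 gtr0_norm.
move=> clz; have [Omz|Omz] := pselect (Om z).
  have : (Om `&` [set z | enorm (z - x - dotv (z - x) nu *: nu) < r /\
      `|dotv (z - x) nu| < h]) z by [].
  rewrite EOm /= => -[_]; rewrite heightE projE g0.
  by move=> /(lt_trans e0); rewrite ltxx.
have : (bdry Om `&` [set z | enorm (z - x - dotv (z - x) nu *: nu) < r /\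
    `|dotv (z - x) nu| < h]) z.
  by split=> //; split=> // /interior_subset.
rewrite Ebd /= => -[_]; rewrite heightE projE g0 => E0.
by rewrite E0 ltxx in e0.
Unshelve. all: by end_near.
Qed.

(** Every ray from the barycenter of [S] starts inside one of the two elements, as their gradients
    are opposite, and so stays in the closure for a while. This contradicts [bdry_escape]. *)
Lemma iside_not_bside S : S \in isides M -> S \notin bsides M Om.
Proof.
rewrite inE => /andP[Ss /existsP[T /andP[TM /existsP[T']]]].
move=> /andP[T'M /andP[TT' /eqP SE]].
apply/negP; rewrite inE => /andP[_ /asboolP Sb].
have cS := card_sides Ss.
have [ST ST'] : S \subset T /\ S \subset T' by rewrite SE finset.subsetIl finset.subsetIr.
have [a aT Ea] := side_opposite hM cS TM ST.
have [a' aT' Ea'] := side_opposite hM cS T'M ST'.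
have [k k0 kE] :=
  opposite_gradients hd hM TM T'M TT' aT aT' (etrans (esym Ea) Ea').
have [w hw] : exists w : E,
    \forall e \near (0 : R)^'+, ~ closure Om (bary S + e *: w).
  by apply/bdry_escape/Sb/bary_in_hull; rewrite cS.
have : \forall e \near (0 : R)^'+, closure Om (bary S + e *: w).
  have [gw|gw] := leP 0 (dotv (bgrad T a) w).
    have := near_hull hd hM TM aT gw; rewrite -Ea.
    by apply: filterS => e; exact: hull_closure.
  have gw' : 0 <= dotv (bgrad T' a') w by rewrite kE dotvZl mulr_le0 ?oppr_le0 ?ltW.
  have := near_hull hd hM T'M aT' gw'; rewrite -Ea'.
  by apply: filterS => e; exact: hull_closure.
move=> hw'; suff /filter_ex[] : \forall e \near (0 : R)^'+, False by [].
by apply: filterS2 hw hw' => e h /h.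
Qed.

(* A point of an element outside [T] in the interior of [S] lies in no further
   element, so the rays leaving [T] through [S] leave the closure of [Om]. *)
Lemma single_side_bdry S T : S \in sides M -> T \in elems M -> S \subset T ->
  (forall T', T' \in elems M -> S \subset T' -> T' = T) -> hull S `<=` bdry Om.
Proof.
move=> Ss TM ST uniqT x Sx; have cS := card_sides Ss.
have [a aT Ea] := side_opposite hM cS TM ST.
have hT := elems_nondegenerate hM TM.
have aS : a \notin S by rewrite Ea !inE eqxx.
have Tx := subset_hull ST Sx.
split; first exact: (hull_closure hM TM).
move=> /interior_subset Omx.
have S0 : (0 < #|S|)%N by rewrite cS.
(* If [x] were interior, it could be moved slightly towards the barycenter of [S], into the relative
   interior of [S], without leaving [Om]. *)
have [e [Ome [e0 e1]]] : exists e : R,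
    Om (x + e *: (bary S - x)) /\ (0 < e /\ e < 1).
  apply: (@filter_ex _ (0 : R)^'+); near=> e; split; last split.
  - by near: e; exact: near_ray.
  - by near: e; exact: nbhs_right_gt.
  - by near: e; exact: nbhs_right_lt.
set y := x + e *: (bary S - x) in Ome.
have yE b : b \in T -> bcoord T b y =
    (1 - e) * bcoord T b x + e * (if b \in S then #|S|%:R^-1 else 0).
  move=> bT; rewrite bcoord_line -(bary_bcoord hT ST S0 bT) /bcoord !dotvBr.
  by ring.
have yS b : b \in S -> 0 < bcoord T b y.
  move=> bS; have bT := fintype.subsetP ST _ bS; rewrite yE // bS.
  rewrite ltr_wpDl // ?mulr_ge0 ?subr_ge0 ?(ltW e1) //.
    by have /hullP := Tx; apply.
  by rewrite mulr_gt0 // invr_gt0 ltr0n.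
have ya : bcoord T a y = 0.
  rewrite yE // (negbTE aS) (bcoord_hull hM TM ST Sx) //.
  by rewrite !mulr0 addr0.
have Ty : hull T y.
  apply/(hullP hT) => b bT; have [bS|bS] := boolP (b \in S); first exact/ltW/yS.
  have -> : b = a by move: bS; rewrite Ea !inE bT andbT negbK => /eqP.
  by rewrite ya.
pose g := bgrad T a.
have gg : 0 < dotv g g.
  by rewrite -sqr_enorm exprn_gt0 // (enorm_bgrad_gt0 hd hT).
have out T' : \forall e \near (0 : R)^'+, T' \in elems M ->
    ~ hull T' (y + e *: (- g)).
  have [T'M|_] := boolP (T' \in elems M); last by near=> e'.
  have hT' := elems_nondegenerate hM T'M.
  have [T'y|T'y] := pselect (hull T' y).
    (* By conformity [y] lies in the hull of the common vertices; as its coordinates at all vertices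
       of [S] are positive, these are all common. *)
    have T'T : T' = T.
      apply: uniqT => //; apply/fintype.subsetP => b bS.
      case: hM => _ _ /(_ T T' TM T'M) hI _.
      have hy : hull (T :&: T') y by rewrite -hI.
      have := bcoord_hull hM TM (finset.subsetIl _ _) hy (fintype.subsetP ST _ bS).
      have [|bT' /(_ isT) b0] := boolP (b \in T :&: T'); first by rewrite inE => /andP[].
      by have := yS b bS; rewrite b0 ltxx.
    rewrite T'T; near=> e' => _ /(hullP hT)/(_ a aT).
    have e'0 : 0 < e' by near: e'; exact: nbhs_right_gt.
    by rewrite bcoord_line ya add0r dotvNr mulrN oppr_ge0 leNgt mulr_gt0.
  have [b bT' yb] : exists2 b, b \in T' & bcoord T' b y < 0.
    apply: contrapT => no; apply: T'y; apply/(hullP hT') => b bT'.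
    by rewrite leNgt; apply/negP => yb; apply: no; exists b.
  have yb' : 0 < - bcoord T' b y by rewrite oppr_gt0.
  have := near_affine_gt0 (dotv (bgrad T' b) g) yb'.
  apply: filterS => e' he' _ /(hullP hT')/(_ b bT').
  by rewrite bcoord_line dotvNr leNgt -oppr_gt0 opprD mulrN opprK he'.
have := filter_forall (at_right_proper_filter 0) out.
have := near_ray (- g) oOm Ome => h1 h2.
suff /filter_ex[] : \forall e \near (0 : R)^'+, False by [].
apply: filterS2 h1 h2 => e' /subset_closure + h2.
by case: hM => _ _ _ -> [T' /= T'M]; exact: h2.
Unshelve. all: by end_near.
Qed.

End BoundarySides.

(** * Sums over elements and sides, and piecewise affine functions *)

Section MeshCalculus.
Variables (R : realType) (d : nat) (Om : set 'rV[R]_d) (M : mesh R d).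
Local Notation E := 'rV[R]_d.
Hypotheses (hd : (0 < d)%N) (hM : triangulation M Om).
Hypothesis hOm : bounded_lipschitz_domain Om.
Implicit Types (S T : {set node M}) (v f : pwfun M) (y w : pwvec M).

Lemma neighbourP S : S \in sides M -> neighbour S \in elems M /\ S \subset neighbour S.
Proof.
rewrite inE => /andP[_ /existsP[T /andP[TM ST]]]; rewrite /neighbour.
by case: pickP => [T' /andP[]|/(_ T)] //=; rewrite TM ST.
Qed.

Lemma vol_elem_gt0 T : T \in elems M -> 0 < vol T.
Proof. by move=> /(elems_nondegenerate hM)/vol_gt0. Qed.

Lemma vol_side_gt0 S : S \in sides M -> 0 < vol S.
Proof.
move=> Ss; have [TM ST] := neighbourP Ss.
have [a aT ->] := side_opposite hM (card_sides Ss) TM ST.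
have hT := elems_nondegenerate hM TM.
by rewrite vol_facet // mulr_gt0 ?enorm_bgrad_gt0 // mulr_gt0 ?ltr0n ?vol_gt0.
Qed.

Lemma shared_side S T T' : S \in sides M -> T \in elems M -> T' \in elems M ->
  S \subset T -> S \subset T' -> T != T' -> S \in isides M.
Proof.
move=> Ss TM T'M ST ST' TT'; rewrite inE Ss /=.
apply/existsP; exists T; rewrite TM /=; apply/existsP; exists T'.
rewrite T'M TT' /= eqEcard finset.subsetI ST ST' (card_sides Ss) /=.
have [cT _] := elems_nondegenerate hM TM.
have [cT' _] := elems_nondegenerate hM T'M.
rewrite -ltnS -cT proper_card // finset.properEneq finset.subsetIl andbT.
apply: contraNneq TT' => /finset.setIidPl TsubT'.
by rewrite eqEcard TsubT' cT cT' leqnn.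
Qed.

Lemma bside_neighbour S T : S \in bsides M Om -> T \in elems M -> S \subset T ->
  T = neighbour S.
Proof.
move=> Sb TM ST; have Ss : S \in sides M by move: Sb; rewrite inE => /andP[].
have [NM SN] := neighbourP Ss; apply/eqP; apply: contraTT Sb => TN.
exact: (iside_not_bside hd hM hOm (shared_side Ss TM NM ST SN TN)).
Qed.

Lemma sum_facets T (F : {set node M} -> R) : T \in elems M ->
  \sum_(a in T) F (T :\ a) = \sum_(S in sides M | S \subset T) F S.
Proof.
move=> TM; have injT : {in T &, injective (fun a => T :\ a)}.
  move=> a b aT bT /setP/(_ a); rewrite !inE eqxx aT andbT /=.
  by case: eqVneq.
rewrite -(big_imset F injT); apply: eq_bigl => S.
apply/imsetP/andP => [[a aT ->]|[Ss ST]].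
  by rewrite (facet_side hM TM aT) subD1set.
by have [a aT ->] := side_opposite hM (card_sides Ss) TM ST; exists a.
Qed.

(** Regrouping by sides. A side outside [bsides] has a second element by [single_side_bdry] and no
    third by [at_most_two_neighbours], so the hypothesis cancels it. A boundary side has one element
    by [iside_not_bside]. *)
Lemma sum_elems_facets (F : {set node M} -> {set node M} -> R) :
  (forall S T T', S \in isides M -> T \in elems M -> T' \in elems M ->
     T != T' -> S \subset T -> S \subset T' -> F T S + F T' S = 0) ->
  \sum_(T in elems M) \sum_(a in T) F T (T :\ a) =
  \sum_(S in bsides M Om) F (neighbour S) S.
Proof.
move=> F0.
transitivity (\sum_(T in elems M) \sum_(S in sides M | S \subset T) F T S).
  by apply: eq_bigr => T TM; exact: sum_facets.
rewrite (exchange_big_dep (mem (sides M))) /= => [|T S _ /andP[]//].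
rewrite (big_setID (bsides M Om)) /= [X in _ + X]big1 ?addr0; last first.
  move=> S; rewrite inE => /andP[Sb Ss].
  have [NM SN] := neighbourP Ss.
  have [/existsP[T /and3P[TM ST TN]]|no] :=
      boolP [exists T, [&& T \in elems M, S \subset T & T != neighbour S]].
    rewrite (bigD1 (neighbour S)) /=; last by rewrite NM Ss SN.
    rewrite (bigD1 T) /=; last by rewrite TM ST Ss TN.
    rewrite big1 ?addr0 => [|T'].
      rewrite addrC F0 //; exact: (shared_side Ss TM NM).
    move=> /andP[/andP[/and3P[T'M _ ST'] T'N] T'T]; exfalso; move/eqP: T'T; apply.
    apply: (at_most_two_neighbours hd hM Ss NM) => //.
      by rewrite eq_sym.
    by rewrite eq_sym.
  exfalso; move/negP: Sb; apply; rewrite inE Ss /=; apply/asboolP.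
  apply: (single_side_bdry hd hM hOm Ss NM SN) => T TM ST.
  by apply/eqP; apply: contraNT no => TN; apply/existsP; exists T; rewrite TM ST.
have bs : {subset bsides M Om <= sides M} by move=> S; rewrite inE => /andP[].
rewrite (finset.setIidPr _); last exact/fintype.subsetP.
apply: eq_bigr => S Sb; have Ss := bs S Sb; have [NM SN] := neighbourP Ss.
rewrite (bigD1 (neighbour S)) /=; last by rewrite NM Ss SN.
rewrite big1 ?addr0 // => T.
move=> /andP[/and3P[TM _ ST] /eqP[]]; exact: bside_neighbour.
Qed.

Section Polynomials.
Variables (v : pwfun M) (w : pwvec M).
Hypothesis hv : pwpoly 1 (elems M) v.
Hypothesis hw : forall i, pwpoly 1 (elems M) (fun T x => w T x 0 i).

Lemma pwpoly1P T : T \in elems M -> exists c, forall x, v T x = c + dotv x (grad (v T) 0).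
Proof.
move=> /hv/poly_deg_le1P[c [b vE]]; exists c => x.
by rewrite (grad_affine _ vE) vE.
Qed.

Lemma grad_pwpoly T x : T \in elems M -> grad (v T) x = grad (v T) 0.
Proof. by move=> /pwpoly1P[c vE]; rewrite !(grad_affine _ vE). Qed.

Lemma mean_pwpoly T S : T \in elems M -> (0 < #|S|)%N -> 0 < vol S ->
  mean S (v T) = v T (bary S).
Proof.
move=> /pwpoly1P[c vE] S0 /lt0r_neq0 vS.
by rewrite (mean_affine S0 vS (c := c) (b := grad (v T) 0)) ?vE.
Qed.

Lemma pwvecP T : T \in elems M -> exists c A, forall x, w T x = c + x *m A.
Proof. by move=> TM; apply/affine_vectorP => i; exact: hw. Qed.

Lemma divg_pwpoly T x : T \in elems M -> divg (w T) x = divg (w T) 0.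
Proof. by move=> /pwvecP[c [A wE]]; rewrite !(divg_affine _ wE). Qed.

Lemma mean_vec_pwpoly T : T \in elems M -> Pihv w T = fun=> w T (bary T).
Proof.
move=> TM; apply: funext => x; apply/rowP => i; rewrite mxE.
have /poly_deg_le1P[c [b wE]] := hw i TM.
have [cT _] := elems_nondegenerate hM TM.
by rewrite (mean_affine _ _ (c := c) (b := b)) ?cT ?gt_eqF ?vol_elem_gt0 // wE.
Qed.

End Polynomials.
End MeshCalculus.

(** * Weak duality *)

Section Functionals.
Variables (R : realType) (d : nat) (Om : set 'rV[R]_d) (M : mesh R d).
Variable Gam : part -> set 'rV[R]_d.
Local Notation E := 'rV[R]_d.
Hypotheses (hd : (0 < d)%N) (hM : triangulation M Om).
Hypothesis hOm : bounded_lipschitz_domain Om.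
Hypothesis hMGam : boundary_fitted M Om Gam.
Implicit Types (C : {set {set node M}}) (S T : {set node M}).
Implicit Types (v f : pwfun M) (y w : pwvec M).
Local Notation Th := (elems M).
Local Notation SI := (psides M Om Gam GammaI).
Local Notation SD := (psides M Om Gam GammaD).
Local Notation SN := (psides M Om Gam GammaN).

Definition side_value v S : R := v (neighbour S) (bary S).
Definition side_flux y T S : R := dotv (y T (bary S)) (outer_normal T S).
Definition bflux y S : R := side_flux y (neighbour S) S.
(** Evaluation at the origin is harmless even outside [T]: for piecewise affine [v], each [v T] is
    affine on the whole space. *)
Definition cgrad v T : E := grad (v T) 0.

Lemma psides_sub X S : S \in psides M Om Gam X -> S \in bsides M Om.
Proof. by rewrite inE => /andP[]. Qed.

Lemma bsides_sub S : S \in bsides M Om -> S \in sides M.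
Proof. by rewrite inE => /andP[]. Qed.

Lemma psides_sides X S : S \in psides M Om Gam X -> S \in sides M.
Proof. by move=> /psides_sub/bsides_sub. Qed.

Lemma isides_sub S : S \in isides M -> S \in sides M.
Proof. by rewrite inE => /andP[]. Qed.

Lemma psides_disjoint X Y S : X <> Y -> S \in psides M Om Gam X ->
  S \notin psides M Om Gam Y.
Proof.
have [_ disj] := hMGam; move=> /disj XY SX; apply/negP => SY.
have : S \in (psides M Om Gam X :&: psides M Om Gam Y)%SET by rewrite inE SX.
by rewrite XY inE.
Qed.

Lemma sum_bsides (F : {set node M} -> R) :
  \sum_(S in bsides M Om) F S =
  \sum_(S in SI) F S + \sum_(S in SD) F S + \sum_(S in SN) F S.
Proof.
have [-> disj] := hMGam.
have sumU C C' : (C :&: C' = finset.set0)%SET -> \sum_(S in C :|: C') F S =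
    \sum_(S in C) F S + \sum_(S in C') F S.
  move=> CC'; rewrite -bigU -?finset.setI_eq0 ?CC' //.
  by apply: eq_bigl => S; rewrite inE.
by rewrite !sumU ?finset.setIUl ?disj ?finset.setU0.
Qed.

Lemma elems_gt0 T : T \in Th -> (0 < #|T|)%N.
Proof. by move=> /(elems_nondegenerate hM)[->]. Qed.

Lemma sides_gt0 S : S \in sides M -> (0 < #|S|)%N.
Proof. by move=> /card_sides ->. Qed.

Lemma mean_poly1 S (f : E -> R) : S \in sides M -> poly_deg_le 1 f ->
  mean S f = f (bary S).
Proof.
move=> Ss /poly_deg_le1P[c [b fE]]; rewrite fE; apply: mean_affine => //.
  exact: sides_gt0.
exact/lt0r_neq0/(vol_side_gt0 hd hM).
Qed.

Lemma sum_integral_cst C (f : pwfun M) (F : {set node M} -> R) :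
  (forall A, A \in C -> (0 < #|A|)%N) ->
  (forall A, A \in C -> forall x, hull A x -> f A x = F A) ->
  \sum_(A in C) integral_on A (f A) = \sum_(A in C) vol A * F A.
Proof.
move=> C0 fF; apply: eq_bigr => A CA.
by rewrite (integral_on_cst (C0 A CA) (fF A CA)).
Qed.

Lemma L2norm_grad v : pwpoly 1 Th v ->
  L2norm Th (pwgrad v) ^+ 2 = \sum_(T in Th) vol T * dotv (cgrad v T) (cgrad v T).
Proof.
move=> pv; rewrite /L2norm (sum_integral_cst
  (F := fun T => dotv (cgrad v T) (cgrad v T))).
- rewrite sqr_sqrtr // sumr_ge0 // => T /(vol_elem_gt0 hM)/ltW vT.
  by rewrite mulr_ge0 ?dotv_ge0.
- exact: elems_gt0.
- by move=> T TM x _; rewrite /pwgrad (grad_pwpoly pv).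
Qed.

Lemma L2norm_mean w : (forall i, pwpoly 1 Th (fun T x => w T x 0 i)) ->
  L2norm Th (Pihv w) ^+ 2 =
  \sum_(T in Th) vol T * dotv (w T (bary T)) (w T (bary T)).
Proof.
move=> pw; rewrite /L2norm (sum_integral_cst
  (F := fun T => dotv (w T (bary T)) (w T (bary T)))).
- rewrite sqr_sqrtr // sumr_ge0 // => T /(vol_elem_gt0 hM)/ltW vT.
  by rewrite mulr_ge0 ?dotv_ge0.
- exact: elems_gt0.
- by move=> T TM x _; rewrite (mean_vec_pwpoly hM pw).
Qed.

Lemma inner_cst C f g (F G : {set node M} -> R) :
  (forall A, A \in C -> (0 < #|A|)%N) ->
  (forall A, A \in C -> forall x, hull A x -> f A x = F A) ->
  (forall A, A \in C -> forall x, hull A x -> g A x = G A) ->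
  inner C f g = \sum_(A in C) vol A * (F A * G A).
Proof.
move=> C0 fF gG; rewrite /inner.
rewrite (sum_integral_cst (f := fun A x => f A x * g A x) (F := fun A => F A * G A)) //.
by move=> A CA x Ax; rewrite (fF A CA) ?(gG A CA).
Qed.

Lemma L1norm_cst C f (F : {set node M} -> R) :
  (forall A, A \in C -> (0 < #|A|)%N) ->
  (forall A, A \in C -> forall x, hull A x -> f A x = F A) ->
  L1norm C f = \sum_(A in C) vol A * `|F A|.
Proof.
move=> C0 fF; rewrite /L1norm.
rewrite (sum_integral_cst (f := fun A x => `|f A x|) (F := fun A => `|F A|)) //.
by move=> A CA x Ax; rewrite (fF A CA).
Qed.

Section Linfnorm.
Variables (C : {set {set node M}}) (f : pwfun M) (F : {set node M} -> R).
Hypothesis CS : {subset C <= sides M}.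
Hypothesis fF : forall A, A \in C -> forall x, hull A x -> f A x = F A.

Let bounds_of := [set c | 0 <= c /\
  forall A, A \in C -> ae_on A (fun x => `|f A x| <= c)].

Let boundsE c : bounds_of c <-> 0 <= c /\ forall A, A \in C -> `|F A| <= c.
Proof.
have ae A : A \in C -> ae_on A (fun x => `|f A x| <= c) <-> `|F A| <= c.
  move=> CA; apply: ae_on_cst; first exact/sides_gt0/CS.
    exact/lt0r_neq0/(vol_side_gt0 hd hM)/CS.
  by move=> x Ax; rewrite (fF CA).
by split=> -[c0 h]; split=> // A CA; apply/(ae A CA)/h.
Qed.

(** Needed for [inf] to be a greatest lower bound; the sum of all moduli bounds each of them. *)
Let bounds_nonempty : bounds_of !=set0.
Proof.
exists (\sum_(B in C) `|F B|); apply/boundsE; split; first exact: sumr_ge0.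
by move=> B BC; rewrite (bigD1 B) //= lerDl sumr_ge0.
Qed.

Lemma Linfnorm_ge0 : 0 <= Linfnorm C f.
Proof. by apply: lb_le_inf => // c /boundsE[]. Qed.

Lemma Linfnorm_ge A : A \in C -> `|F A| <= Linfnorm C f.
Proof. by move=> CA; apply: lb_le_inf => // c /boundsE[_]; apply. Qed.

Lemma Linfnorm_le c : 0 <= c -> (forall A, A \in C -> `|F A| <= c) ->
  Linfnorm C f <= c.
Proof.
move=> c0 h; apply: ge_inf; last exact/boundsE.
by exists 0 => x /boundsE[].
Qed.

End Linfnorm.

End Functionals.

(** * Functionals as finite sums, the discrete Green formula, and the inequality between the dual
    and primal values *)

Section Duality.
Variables (R : realType) (d : nat) (Om : set 'rV[R]_d) (M : mesh R d).
Variable Gam : part -> set 'rV[R]_d.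
Local Notation E := 'rV[R]_d.
Hypotheses (hd : (0 < d)%N) (hM : triangulation M Om).
Hypothesis hOm : bounded_lipschitz_domain Om.
Hypothesis hMGam : boundary_fitted M Om Gam.
Variables (m : R) (fh gh uD : pwfun M).
Hypothesis hm : 0 < m.
Implicit Types (S T : {set node M}) (v : pwfun M) (y : pwvec M).
Local Notation Th := (elems M).
Local Notation SI := (psides M Om Gam GammaI).
Local Notation SD := (psides M Om Gam GammaD).
Local Notation SN := (psides M Om Gam GammaN).
Hypothesis hf : pwpoly 0 Th fh.
Hypothesis hg : pwpoly 0 SN gh.
Hypothesis huD : pwpoly 0 SD uD.

Lemma pwpoly0E C (f : pwfun M) A x : pwpoly 0 C f -> A \in C -> f A x = f A 0.
Proof. by move=> h /h[c fE]; rewrite !fE. Qed.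

Lemma pih_side v S x : CR v -> S \in sides M -> pih v S x = side_value v S.
Proof.
move=> [pv _] Ss; have [NM _] := neighbourP Ss.
by rewrite /pih (mean_pwpoly pv NM) ?sides_gt0 ?(vol_side_gt0 hd hM).
Qed.

Lemma RT_flux y T S x : RT y -> T \in Th -> S \in sides M -> S \subset T ->
  hull S x -> dotv (y T x) (outer_normal T S) = side_flux y T S.
Proof.
move=> [_ h _] TM Ss ST Sx; have [c hc] := h T S TM Ss ST.
by rewrite hc // -(hc (bary S)) //; apply/bary_in_hull/sides_gt0.
Qed.

Lemma ntrace_side y S x : RT y -> S \in sides M -> hull S x ->
  ntrace y S x = bflux y S.
Proof.
by move=> hy Ss Sx; have [NM SN] := neighbourP Ss; rewrite /ntrace RT_flux.
Qed.

Lemma dirichletE v : CR v ->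
  dirichlet Om Gam uD v <-> forall S, S \in SD -> side_value v S = uD S 0.
Proof.
move=> hv; have ae S : S \in SD ->
    ae_on S (fun x => pih v S x = uD S x) <-> side_value v S = uD S 0.
  move=> SS; have Ss := psides_sides SS.
  apply: ae_on_cst; [exact: sides_gt0|exact/lt0r_neq0/(vol_side_gt0 hd hM)|].
  by move=> x _; rewrite pih_side // (pwpoly0E _ huD).
by split=> h S SS; apply/(ae S SS)/h.
Qed.

Definition primal_value v : R :=
  1 / 2 * (\sum_(T in Th) vol T * dotv (cgrad v T) (cgrad v T))
  + 1 / (2 * m) * (\sum_(S in SI) vol S * `|side_value v S|) ^+ 2
  - \sum_(T in Th) vol T * (fh T 0 * v T (bary T))
  - \sum_(S in SN) vol S * (gh S 0 * side_value v S).

Lemma IcrE v : CR v -> dirichlet Om Gam uD v ->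
  Icr Om Gam m fh gh uD v = (primal_value v)%:E.
Proof.
move=> hv hD; have [pv _] := hv.
rewrite /Icr asboolT // (L2norm_grad hM pv).
rewrite (L1norm_cst (F := side_value v)); last 2 first.
- by move=> S /psides_sides/sides_gt0; apply.
- by move=> S /psides_sides SS x _; rewrite pih_side.
rewrite (inner_cst (F := fun T => fh T 0) (G := fun T => v T (bary T))); last 3 first.
- exact: (elems_gt0 hM).
- by move=> T TM x _; rewrite (pwpoly0E _ hf).
- move=> T TM x _; rewrite /Pih (mean_pwpoly pv TM) ?(elems_gt0 hM) //.
  exact: (vol_elem_gt0 hM).
rewrite (inner_cst (F := fun S => gh S 0) (G := side_value v)) //.
- by move=> S /psides_sides/sides_gt0; apply.
- by move=> S SS x _; rewrite (pwpoly0E _ hg).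
- by move=> S /psides_sides SS x _; rewrite pih_side.
Qed.

Lemma KrtE y : Krt Om Gam fh gh y <->
  [/\ RT y, forall T, T \in Th -> divg (y T) 0 = - fh T 0
    & forall S, S \in SN -> bflux y S = gh S 0].
Proof.
split=> -[hy hdiv hN]; have [py _ _] := hy.
all: have aeT T : T \in Th -> ae_on T (fun x => divg (y T) x = - fh T x) <->
    divg (y T) 0 = - fh T 0.
1,3: move=> TM; apply: ae_on_cst;
  [exact: (elems_gt0 hM)|exact/lt0r_neq0/(vol_elem_gt0 hM)|];
  by move=> x _; rewrite (divg_pwpoly py) // (pwpoly0E _ hf).
all: have aeS S : S \in SN -> ae_on S (fun x => ntrace y S x = gh S x) <->
    bflux y S = gh S 0.
1,3: move=> SS; have Ss := psides_sides SS; apply: ae_on_cst;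
  [exact: sides_gt0|exact/lt0r_neq0/(vol_side_gt0 hd hM)|];
  by move=> x Sx; rewrite ntrace_side // (pwpoly0E _ hg).
all: split=> // [T TM|S SS]; first by apply/(aeT T TM)/hdiv.
all: by apply/(aeS S SS)/hN.
Qed.

Definition dual_value y : R :=
  - (1 / 2) * (\sum_(T in Th) vol T * dotv (y T (bary T)) (y T (bary T)))
  - m / 2 * Linfnorm SI (ntrace y) ^+ 2
  + \sum_(S in SD) vol S * (bflux y S * uD S 0).

Lemma DrtE y : Krt Om Gam fh gh y ->
  Drt Om Gam m fh gh uD y = (dual_value y)%:E.
Proof.
move=> hy; rewrite /Drt asboolT //; have [hRT _ _] := hy; have [py _ _] := hRT.
rewrite (L2norm_mean hM py) (inner_cst (F := bflux y) (G := fun S => uD S 0)) //.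
- by move=> S /psides_sides/sides_gt0; apply.
- by move=> S /psides_sides SS x Sx; rewrite ntrace_side.
- by move=> S SS x _; rewrite (pwpoly0E _ huD).
Qed.

Definition facetwise_constant_flux y T := forall a x, a \in T ->
  hull (T :\ a) x ->
  dotv (y T x) (outer_normal T (T :\ a)) = side_flux y T (T :\ a).

Lemma green_elem v y T : pwpoly 1 Th v ->
  (forall i, pwpoly 1 Th (fun T x => y T x 0 i)) ->
  T \in Th -> facetwise_constant_flux y T ->
  vol T * (dotv (cgrad v T) (y T (bary T)) + v T (bary T) * divg (y T) 0) =
  \sum_(a in T) vol (T :\ a) * (v T (bary (T :\ a)) * side_flux y T (T :\ a)).
Proof.
move=> pv py TM hy; have [c vE] := pwpoly1P pv TM.
have [w0 [A yE]] := pwvecP py TM; rewrite (divg_affine _ yE).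
apply: (local_green hd (elems_nondegenerate hM TM) vE yE
  (C := fun a => side_flux y T (T :\ a))).
exact: hy.
Qed.

(** The jump is affine, so its mean on the side is its value at the barycenter. *)
Lemma CR_side_value v S T T' : CR v -> S \in isides M -> T \in Th -> T' \in Th ->
  T != T' -> S \subset T -> S \subset T' -> v T (bary S) = v T' (bary S).
Proof.
move=> [pv jump] Si TM T'M TT' ST ST'; have := jump S T T' Si TM T'M TT' ST ST'.
have Ss : S \in sides M by move: Si; rewrite inE => /andP[].
have [c vE] := pwpoly1P pv TM; have [c' vE'] := pwpoly1P pv T'M.
rewrite (mean_affine (c := c - c') (b := cgrad v T - cgrad v T')).
- by rewrite vE vE' dotvBr => /eqP; rewrite addrACA -opprD subr_eq0 => /eqP.
- exact: sides_gt0.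
- exact/lt0r_neq0/(vol_side_gt0 hd hM).
- by move=> x _; rewrite vE vE' dotvBr; ring.
Qed.

Lemma RT_facets y T : RT y -> T \in Th -> facetwise_constant_flux y T.
Proof.
move=> hy TM a x aT Sx; apply: RT_flux => //; last exact: subD1set.
exact: (facet_side hM).
Qed.

Lemma discrete_green v y : CR v -> RT y ->
  \sum_(T in Th) vol T *
    (dotv (cgrad v T) (y T (bary T)) + v T (bary T) * divg (y T) 0) =
  \sum_(S in bsides M Om) vol S * (side_value v S * bflux y S).
Proof.
move=> hv hy; have [pv _] := hv; have [py _ jump] := hy.
rewrite -(sum_elems_facets hd hM hOm
  (F := fun T S => vol S * (v T (bary S) * side_flux y T S))).
  by apply: eq_bigr => T TM; apply: green_elem => //; exact: RT_facets.
move=> S T T' Si TM T'M TT' ST ST'.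
have Ss : S \in sides M by move: Si; rewrite inE => /andP[].
have bS := bary_in_hull (sides_gt0 hd Ss).
rewrite (CR_side_value hv Si TM T'M) // -mulrDr -mulrDr.
by rewrite /side_flux (jump S T T' Si TM T'M TT' ST ST' _ bS) !mulr0.
Qed.

Lemma weak_duality v y : CR v -> dirichlet Om Gam uD v -> Krt Om Gam fh gh y ->
  dual_value y <= primal_value v.
Proof.
move=> hv hD hy; have [hRT _ _] := hy.
have /KrtE[_ hdiv hN] := hy; have /(dirichletE hv) hvD := hD.
have := discrete_green hv hRT.
rewrite (sum_bsides hMGam).
set bI := \sum_(S in SI) _; set bD := \sum_(S in SD) _; set bN := \sum_(S in SN) _.
have -> : \sum_(T in Th) vol T *
    (dotv (cgrad v T) (y T (bary T)) + v T (bary T) * divg (y T) 0) =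
  \sum_(T in Th) vol T * dotv (cgrad v T) (y T (bary T)) -
  \sum_(T in Th) vol T * (fh T 0 * v T (bary T)).
  by rewrite -sumrB; apply: eq_bigr => T TM; rewrite hdiv //; ring.
rewrite /dual_value /primal_value.
set X := \sum_(T in Th) vol T * dotv (cgrad v T) (y T (bary T)).
set F := \sum_(T in Th) vol T * (fh T 0 * v T (bary T)).
set A := \sum_(T in Th) vol T * dotv (cgrad v T) (cgrad v T).
set B := \sum_(T in Th) vol T * dotv (y T (bary T)) (y T (bary T)).
set L := \sum_(S in SI) vol S * `|side_value v S|.
set N := Linfnorm _ _.
have -> : \sum_(S in SN) vol S * (gh S 0 * side_value v S) = bN.
  by apply: eq_bigr => S SS; rewrite hN // [gh S 0 * _]mulrC.
have -> : \sum_(S in SD) vol S * (bflux y S * uD S 0) = bD.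
  by apply: eq_bigr => S SS; rewrite hvD // [uD S 0 * _]mulrC.
have ABX : 0 <= A + B - 2 * X.
  have -> : A + B - 2 * X = \sum_(T in Th) vol T *
      dotv (cgrad v T - y T (bary T)) (cgrad v T - y T (bary T)).
    rewrite mulr_sumr -big_split -sumrB /=; apply: eq_bigr => T TM.
    rewrite dotvBl !dotvBr (dotvC (y T (bary T)) (cgrad v T)); ring.
  apply: sumr_ge0 => T /(vol_elem_gt0 hM)/ltW vT.
  by rewrite mulr_ge0 ?dotv_ge0.
(* Hoelder's inequality for the side sum comes first, because the penalty is the square of a whole
   norm; Young's inequality with weight [m] is then applied once, to the product [N * L]. *)
have bIN : - bI <= N * L.
  apply: (le_trans (ler_norm _)); rewrite normrN.
  apply: (le_trans (ler_norm_sum _ _ _)); rewrite mulr_sumr.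
  apply: ler_sum => S SS; have Ss := psides_sides SS.
  have vS := ltW (vol_side_gt0 hd hM Ss).
  rewrite (normrM (vol S)) (normrM (side_value v S)) (ger0_norm vS).
  rewrite [leRHS]mulrCA ler_wpM2l // mulrC ler_wpM2r //.
  apply: (Linfnorm_ge hd hM _ (F := bflux y)) => // [S'|S' /psides_sides S's x S'x].
    exact: psides_sides.
  exact: ntrace_side.
move=> green.
have young : N * L <= 1 / (2 * m) * L ^+ 2 + m / 2 * N ^+ 2.
  rewrite -subr_ge0 [X in 0 <= X](_ : _ = 1 / (2 * m) * (L - m * N) ^+ 2).
    by rewrite mulr_ge0 ?sqr_ge0 // divr_ge0 // mulr_ge0 // ltW.
  by field; rewrite gt_eqF.
lra.
Qed.

End Duality.

(** * Optimality and Marini's field *)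

Lemma quad_ge0 (R : realFieldType) (a b : R) :
  (forall t, 0 < t -> t < 1 -> 0 <= t * a + t ^+ 2 * b) -> 0 <= a.
Proof.
move=> h; rewrite leNgt; apply/negP => a0.
have b0 := normr_ge0 b; have bb := ler_norm b.
have den : 0 < 2 * (`|b| - a) by lra.
(* Chosen so that t (|b| - a) = -a/2; then t < 1 and a + t b is at most a/2 + t a, which is
   negative. *)
pose t := - a / (2 * (`|b| - a)).
have t0 : 0 < t by rewrite divr_gt0 // oppr_gt0.
have t1 : t < 1 by rewrite ltr_pdivrMr //; lra.
have := h t t0 t1; rewrite expr2 -mulrA -mulrDr pmulr_rge0 //.
have tb : t * b <= t * `|b| by rewrite ler_pM2l.
have : t * (2 * (`|b| - a)) = - a by rewrite divfK // gt_eqF.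
have : t * a < 0 by rewrite pmulr_rlt0.
nra.
Qed.

(* Stationarity at [t = 0]; the subdifferential of the absolute value gives the
   bound on [a] when [q = 0]. *)
Lemma sqr_norm_optimality (R : realFieldType) (m a b s L q : R) :
  0 < m -> 0 <= s -> s * `|q| <= L ->
  (forall t, 0 <= t * a + t ^+ 2 * b +
    1 / (2 * m) * ((L + s * (`|q + t| - `|q|)) ^+ 2 - L ^+ 2)) ->
  `|a| <= L * s / m /\ q * a = - (L * s / m * `|q|).
Proof.
move=> m0 s0 sqL h.
have q0 := normr_ge0 q.
have sq0 : 0 <= s * `|q| by rewrite mulr_ge0.
have L0 : 0 <= L by lra.
(* Moves by +t and -t, encoded by a sign [e]. The triangle inequality replaces the absolute value by
   |q| + t and makes the condition quadratic in t. *)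
have one_sided e : e ^+ 2 = 1 -> 0 <= e * a + L * s / m.
  move=> e2; have e1 : `|e| = 1.
    by apply/eqP; rewrite -(eqrXn2 (n := 2)) // expr1n -normrX e2 normr1.
  apply: (@quad_ge0 _ _ (b + s ^+ 2 / (2 * m))) => t t0 t1.
  apply: (le_trans (h (e * t))).
  have -> : t * (e * a + L * s / m) + t ^+ 2 * (b + s ^+ 2 / (2 * m)) =
      e * t * a + (e * t) ^+ 2 * b + 1 / (2 * m) * ((L + s * t) ^+ 2 - L ^+ 2).
    by rewrite exprMn e2; field; rewrite gt_eqF.
  rewrite lerD2l; apply: ler_wpM2l; first by rewrite divr_ge0 // mulr_ge0 // ltW.
  rewrite lerD2r.
  have qt : `|q + e * t| <= `|q| + t.
    by rewrite (le_trans (ler_normD _ _)) // normrM e1 mul1r gtr0_norm.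
  have qt0 := normr_ge0 (q + e * t).
  rewrite ler_pXn2r // ?nnegrE.
  - by rewrite lerD2l ler_wpM2l // lerBlDl.
  - have : 0 <= s * `|q + e * t| by rewrite mulr_ge0.
    by rewrite mulrBr; lra.
  - by rewrite addr_ge0 // mulr_ge0 // ltW.
have a1 := one_sided 1 (expr1n _ _).
have a2 := one_sided (-1) (sqrr_sign _ 1).
have na : `|a| <= L * s / m by rewrite ler_norml; lra.
split=> //; apply/eqP; rewrite eq_le; apply/andP; split; last first.
  have : `|q * a| <= L * s / m * `|q| by rewrite normrM mulrC ler_wpM2r.
  by rewrite ler_norml => /andP[].
have : 0 <= - (q * a) - L * s / m * `|q|; last by lra.
(* The perturbation -t q shrinks [q] towards 0, so |q - t q| = (1 - t) |q| without distinguishing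
   the sign of [q]. *)
apply: (@quad_ge0 _ _ (q ^+ 2 * b + s ^+ 2 * `|q| ^+ 2 / (2 * m))) => t t0 t1.
apply: (le_trans (h (- t * q))).
have -> : `|q + - t * q| = (1 - t) * `|q|.
  by rewrite -{1}[q]mul1r -mulrDl normrM ger0_norm // subr_ge0 ltW.
have -> : t * (- (q * a) - L * s / m * `|q|) +
    t ^+ 2 * (q ^+ 2 * b + s ^+ 2 * `|q| ^+ 2 / (2 * m)) =
    - t * q * a + (- t * q) ^+ 2 * b +
    1 / (2 * m) * ((L + s * ((1 - t) * `|q| - `|q|)) ^+ 2 - L ^+ 2).
  by field; rewrite gt_eqF.
exact: lexx.
Qed.

(** * Crouzeix-Raviart basis functions, Marini's field and its optimality *)

Section Marini.
Variables (R : realType) (d : nat) (Om : set 'rV[R]_d) (M : mesh R d).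
Variable Gam : part -> set 'rV[R]_d.
Local Notation E := 'rV[R]_d.
Hypotheses (hd : (0 < d)%N) (hM : triangulation M Om).
Hypothesis hOm : bounded_lipschitz_domain Om.
Hypothesis hMGam : boundary_fitted M Om Gam.
Variables (m : R) (fh gh uD : pwfun M).
Hypothesis hm : 0 < m.
Implicit Types (S T : {set node M}) (v : pwfun M) (y : pwvec M).
Local Notation Th := (elems M).
Local Notation SI := (psides M Om Gam GammaI).
Local Notation SD := (psides M Om Gam GammaD).
Local Notation SN := (psides M Om Gam GammaN).
Hypothesis hf : pwpoly 0 Th fh.
Hypothesis hg : pwpoly 0 SN gh.
Hypothesis huD : pwpoly 0 SD uD.

(** The usual basis function of a side. For an element T containing [S] exactly one summand
    survives, that of the vertex opposite [S]; on other elements the sum is empty and gives 0. *)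
Definition cr_basis S : pwfun M := fun T x =>
  \sum_(a in T | T :\ a == S) (1 - d%:R * bcoord T a x).

Lemma cr_basis_poly S : pwpoly 1 Th (cr_basis S).
Proof.
move=> T TM; apply/poly_deg_le1P.
exists (\sum_(a in T | T :\ a == S)
  (1 - d%:R * (d.+1%:R^-1 - dotv (bgrad T a) (bary T)))),
  (\sum_(a in T | T :\ a == S) - d%:R *: bgrad T a) => x.
rewrite dotv_sumr -big_split /=; apply: eq_bigr => a _.
by rewrite /bcoord dotvBr (dotvC x) dotvZl; ring.
Qed.

Lemma cr_basis_bary S T S' : T \in Th -> S' \in sides M -> S' \subset T ->
  cr_basis S T (bary S') = (S' == S)%:R.
Proof.
move=> TM S's S'T; have cS' := card_sides S's.
have [b bT Eb] := side_opposite hM cS' TM S'T.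
have hT := elems_nondegenerate hM TM.
have d0 : d%:R != 0 :> R by rewrite pnatr_eq0 -lt0n.
have valE a : a \in T -> 1 - d%:R * bcoord T a (bary S') = (a == b)%:R.
  move=> aT; rewrite (bary_bcoord hT) ?cS' // Eb !inE aT andbT.
  by case: eqVneq => [_|_] /=; rewrite ?mulr0 ?subr0 // mulfV // subrr.
rewrite /cr_basis; under eq_bigr => a /andP[aT _] do rewrite valE //.
have [S'S|S'S] := eqVneq S' S; last first.
  apply: big1 => a /andP[_ /eqP TaS]; case: eqVneq => // ab.
  by rewrite ab -Eb in TaS; rewrite TaS eqxx in S'S.
rewrite (bigD1 b) /=; last by rewrite bT -Eb S'S eqxx.
by rewrite eqxx big1 ?addr0 // => a /andP[_ /negbTE ->].
Qed.

Lemma CR_perturb v S t : CR v -> CR (fun T x => v T x + t * cr_basis S T x).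
Proof.
move=> hv; have [pv _] := hv.
have pvt : pwpoly 1 Th (fun T x => v T x + t * cr_basis S T x).
  by move=> T TM; apply: poly_deg_le1_lin; [exact: pv|exact: cr_basis_poly].
split=> // S' T T' S'i TM T'M TT' S'T S'T'; have S's := isides_sub S'i.
rewrite (_ : (fun x => _) = fun x => (v T x + t * cr_basis S T x) +
    -1 * (v T' x + t * cr_basis S T' x)); last by apply: funext => x; rewrite mulN1r.
rewrite (mean_poly1 hd hM) //; last by apply: poly_deg_le1_lin; exact: pvt.
rewrite (CR_side_value hd hM hv S'i TM T'M TT' S'T S'T').
by rewrite !cr_basis_bary // mulN1r subrr.
Qed.

Lemma side_value_perturb v S S' t : S' \in sides M ->
  side_value (fun T x => v T x + t * cr_basis S T x) S' =
  side_value v S' + t * (S' == S)%:R.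
Proof.
move=> S's; have [NM S'N] := neighbourP S's.
by rewrite /side_value cr_basis_bary.
Qed.

Lemma cgrad_perturb v S t T : pwpoly 1 Th v -> T \in Th ->
  cgrad (fun T x => v T x + t * cr_basis S T x) T =
  cgrad v T + t *: cgrad (cr_basis S) T.
Proof.
move=> pv TM; have [c vE] := pwpoly1P pv TM.
have [e pE] := pwpoly1P (cr_basis_poly S) TM.
rewrite /cgrad (@grad_affine _ _ _ (c + t * e)
  (cgrad v T + t *: cgrad (cr_basis S) T)) //.
by move=> x; rewrite vE pE dotvDr dotvZr /cgrad; ring.
Qed.

Variable u : pwfun M.
Hypothesis hu : primal_minimizer Om Gam m fh gh uD u.

(* Marini's formula for a Raviart-Thomas field from a Crouzeix-Raviart one *)
Definition marini : pwvec M :=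
  fun T x => cgrad u T - (fh T 0 / d%:R) *: (x - bary T).

Let huCR : CR u. Proof. by case: hu => -[]. Qed.
Let huDir : dirichlet Om Gam uD u. Proof. by case: hu => -[]. Qed.

Lemma mariniE T x : marini T x =
  cgrad u T + (fh T 0 / d%:R) *: bary T + x *m (- (fh T 0 / d%:R))%:M.
Proof.
by rewrite /marini mul_mx_scalar scalerBr opprB addrA scaleNr.
Qed.

Lemma marini_poly i : pwpoly 1 Th (fun T x => marini T x 0 i).
Proof.
move=> T _; move: i; apply/affine_vectorP.
by eexists; eexists => x; exact: mariniE.
Qed.

Lemma divg_marini T : divg (marini T) 0 = - fh T 0.
Proof.
rewrite (divg_affine _ (mariniE T)) mxtrace_scalar -[LHS]mulr_natr mulNr divfK //.
by rewrite pnatr_eq0 -lt0n.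
Qed.

Lemma marini_bary T : marini T (bary T) = cgrad u T.
Proof. by rewrite /marini subrr scaler0 subr0. Qed.

(** Along the facet opposite [a] the coordinate of [a] vanishes, so x - x_T has the constant product
    -1/(d+1) with the gradient. *)
Lemma marini_facets T : T \in Th -> facetwise_constant_flux marini T.
Proof.
move=> TM a x aT Sx; have hT := elems_nondegenerate hM TM.
have aS : a \notin T :\ a by rewrite !inE eqxx.
have bc z : hull (T :\ a) z -> dotv (bgrad T a) (z - bary T) = - d.+1%:R^-1.
  move=> /(bcoord_hull hM TM (subD1set _ _))/(_ aT aS) /eqP.
  by rewrite /bcoord addrC addr_eq0 => /eqP.
rewrite /side_flux /marini outer_normalE // !dotvZr !dotvBl !dotvZl.
rewrite !(dotvC (_ - bary T)) !bc //.
by apply: bary_in_hull; rewrite card_facet.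
Qed.

(** On an interior side this is the jump of the normal component, on a boundary side the normal
    trace. *)
Definition net_flux S : R := \sum_(T in Th | S \subset T) side_flux marini T S.

(** Green's formula is applied element by element, since [marini] is not yet known to have
    continuous normal components; the failure of continuity is what [net_flux] records. *)
Lemma cr_basis_green S : S \in sides M ->
  \sum_(T in Th) vol T * dotv (cgrad u T) (cgrad (cr_basis S) T) -
  \sum_(T in Th) vol T * (fh T 0 * cr_basis S T (bary T)) = vol S * net_flux S.
Proof.
move=> Ss; rewrite -sumrB.
transitivity (\sum_(T in Th) vol T * (dotv (cgrad (cr_basis S) T) (marini T (bary T))
    + cr_basis S T (bary T) * divg (marini T) 0)).
  by apply: eq_bigr => T TM; rewrite marini_bary divg_marini (dotvC (cgrad u T)); ring.
transitivity (\sum_(T in Th) \sum_(S' in sides M | S' \subset T)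
    vol S' * ((S' == S)%:R * side_flux marini T S')).
  apply: eq_bigr => T TM.
  rewrite (green_elem hd hM (cr_basis_poly S) marini_poly TM (marini_facets TM)).
  rewrite (sum_facets hM (fun S' => vol S' *
    (cr_basis S T (bary S') * side_flux marini T S')) TM).
  by apply: eq_bigr => S' /andP[S's S'T]; rewrite cr_basis_bary.
rewrite /net_flux mulr_sumr [RHS]big_mkcondr /=; apply: eq_bigr => T TM.
case: ifPn => ST; last first.
  apply: big1 => S' /andP[_ S'T]; case: eqVneq => [S'S|]; last by rewrite mul0r mulr0.
  by rewrite S'S (negbTE ST) in S'T.
rewrite (bigD1 S) /= ?Ss ?ST // eqxx mul1r big1 ?addr0 // => S' /andP[_ /negbTE ->].
by rewrite mul0r mulr0.
Qed.

Lemma minimality v : CR v -> dirichlet Om Gam uD v ->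
  primal_value Om Gam m fh gh u <= primal_value Om Gam m fh gh v.
Proof.
move=> hv hD; have [_ /(_ v hv)] := hu.
by rewrite !(IcrE hd hM m hf hg) // lee_fin.
Qed.

Let L := \sum_(S in SI) vol S * `|side_value u S|.

(* Stationarity in the single degree of freedom attached to the side [S]. *)
Lemma side_optimality S : S \in sides M -> S \notin SD ->
  let a := vol S * net_flux S - (if S \in SN then vol S * gh S 0 else 0) in
  let s := if S \in SI then vol S else 0 in
  `|a| <= L * s / m /\
  side_value u S * a = - (L * s / m * `|side_value u S|).
Proof.
move=> Ss SnD a s; have vS := vol_side_gt0 hd hM Ss.
have sumI (G : {set node M} -> R) (hG : forall S', S' != S -> G S' = 0) :
    \sum_(S' in SI) G S' = if S \in SI then G S else 0.
  rewrite big_mkcond (bigD1 S) //= big1 ?addr0 // => S' S'S.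
  by rewrite hG //; case: ifP.
have sumN (G : {set node M} -> R) (hG : forall S', S' != S -> G S' = 0) :
    \sum_(S' in SN) G S' = if S \in SN then G S else 0.
  rewrite big_mkcond (bigD1 S) //= big1 ?addr0 // => S' S'S.
  by rewrite hG //; case: ifP.
have [pu _] := huCR.
(* Here [a] is the derivative of the smooth part of the energy along the basis function and [s] the
   weight of this side in the penalty; off Gamma_I the weight is 0 and the conclusion forces a =
   0. *)
apply: (sqr_norm_optimality hm (b := 1 / 2 *
  \sum_(T in Th) vol T * dotv (cgrad (cr_basis S) T) (cgrad (cr_basis S) T))).
- by rewrite /s; case: ifP => // _; exact: ltW.
- rewrite /s; case: ifPn => SS; last by rewrite mul0r sumr_ge0 // => S' /psides_sides
    /(vol_side_gt0 hd hM)/ltW vS'; rewrite mulr_ge0.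
  rewrite /L (bigD1 S) //= lerDl sumr_ge0 // => S' /andP[/psides_sides
    /(vol_side_gt0 hd hM)/ltW vS' _]; by rewrite mulr_ge0.
move=> t; pose ut : pwfun M := fun T x => u T x + t * cr_basis S T x.
have hut : CR ut by exact: CR_perturb.
have hDt : dirichlet Om Gam uD ut.
  apply/(dirichletE hd hM huD hut) => S' S'D.
  have /(dirichletE hd hM huD huCR) := huDir.
  rewrite /ut side_value_perturb ?(psides_sides S'D) // => -> //.
  have [S'S|_] := eqVneq S' S; last by rewrite mulr0 addr0.
  by rewrite -S'S S'D in SnD.
have := minimality hut hDt; rewrite -subr_ge0.
congr (0 <= _); rewrite /primal_value -/L.
have gE : \sum_(T in Th) vol T * dotv (cgrad ut T) (cgrad ut T) =
  \sum_(T in Th) vol T * dotv (cgrad u T) (cgrad u T) +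
  2 * t * (\sum_(T in Th) vol T * dotv (cgrad u T) (cgrad (cr_basis S) T)) +
  t ^+ 2 * (\sum_(T in Th) vol T *
     dotv (cgrad (cr_basis S) T) (cgrad (cr_basis S) T)).
  rewrite !mulr_sumr -!big_split /=; apply: eq_bigr => T TM.
  rewrite cgrad_perturb // !dotvDl !dotvDr !dotvZl !dotvZr.
  by rewrite (dotvC (cgrad (cr_basis S) T) (cgrad u T)); ring.
have fE : \sum_(T in Th) vol T * (fh T 0 * ut T (bary T)) =
    \sum_(T in Th) vol T * (fh T 0 * u T (bary T)) +
    t * \sum_(T in Th) vol T * (fh T 0 * cr_basis S T (bary T)).
  rewrite mulr_sumr -big_split /=; apply: eq_bigr => T TM.
  by rewrite /ut; ring.
have nE : \sum_(S' in SN) vol S' * (gh S' 0 * side_value ut S') =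
    \sum_(S' in SN) vol S' * (gh S' 0 * side_value u S') +
    t * (if S \in SN then vol S * gh S 0 else 0).
  rewrite (_ : (if _ then _ else _) =
      \sum_(S' in SN) vol S' * gh S' 0 * (S' == S)%:R); last first.
    by rewrite sumN ?eqxx ?mulr1 // => S' /negbTE ->; rewrite mulr0.
  rewrite mulr_sumr -big_split /=; apply: eq_bigr => S' /psides_sides S's.
  by rewrite side_value_perturb //; ring.
have lE : \sum_(S' in SI) vol S' * `|side_value ut S'| =
    L + s * (`|side_value u S + t| - `|side_value u S|).
  rewrite (_ : s * _ = \sum_(S' in SI) vol S' *
      (`|side_value u S' + t * (S' == S)%:R| - `|side_value u S'|)); last first.
    rewrite sumI => [|S' /negbTE ->]; last by rewrite mulr0 addr0 subrr mulr0.
    by rewrite eqxx mulr1 /s; case: ifP; rewrite ?mul0r.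
  rewrite /L -big_split /=; apply: eq_bigr => S' /psides_sides S's.
  by rewrite side_value_perturb //; ring.
rewrite gE fE nE lE /a -cr_basis_green //.
by field; rewrite gt_eqF.
Qed.

Lemma net_flux_bside S : S \in bsides M Om -> net_flux S = bflux marini S.
Proof.
move=> Sb; have Ss := bsides_sub Sb; have [NM SN'] := neighbourP Ss.
rewrite /net_flux (bigD1 (neighbour S)) ?NM ?SN' //= big1 ?addr0 // => T.
move=> /andP[/andP[TM ST] /eqP[]].
exact: (bside_neighbour hd hM hOm).
Qed.

Lemma net_flux_iside S T T' : S \in sides M -> T \in Th -> T' \in Th ->
  T != T' -> S \subset T -> S \subset T' ->
  net_flux S = side_flux marini T S + side_flux marini T' S.
Proof.
move=> Ss TM T'M TT' ST ST'.
rewrite /net_flux (bigD1 T) ?TM ?ST //= (bigD1 T') /=; last first.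
  by rewrite T'M ST' eq_sym.
rewrite big1 ?addr0 // => T2 /andP[/andP[/andP[T2M ST2] T2T] /eqP[]].
apply: (at_most_two_neighbours hd hM Ss TM) => //.
by rewrite eq_sym.
Qed.

(** An interior side carries neither a load nor a penalty, so optimality there says that the two
    outward fluxes cancel. *)
Lemma RT_marini : RT marini.
Proof.
have flux T S x : T \in Th -> S \in sides M -> S \subset T -> hull S x ->
    dotv (marini T x) (outer_normal T S) = side_flux marini T S.
  move=> TM Ss ST; have [a aT ->] := side_opposite hM (card_sides Ss) TM ST.
  exact: marini_facets.
split=> [|T S TM Ss ST|S T T' Si TM T'M TT' ST ST' x Sx].
- exact: marini_poly.
- by exists (side_flux marini T S) => x; exact: flux.
have Ss := isides_sub Si.
have Snb := iside_not_bside hd hM hOm Si.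
have SnX X : S \notin psides M Om Gam X by apply: contra Snb => /psides_sub.
rewrite !flux //.
have [+ _] := side_optimality Ss (SnX GammaD).
rewrite !(negbTE (SnX _)) subr0 mulr0 mul0r normr_le0 mulf_eq0.
rewrite (gt_eqF (vol_side_gt0 hd hM Ss)) /= => /eqP.
by rewrite (net_flux_iside Ss TM T'M TT' ST ST').
Qed.

Lemma Krt_marini : Krt Om Gam fh gh marini.
Proof.
apply/(KrtE hd hM hf hg); split=> [||S SS]; first exact: RT_marini.
  by move=> T _; exact: divg_marini.
have Ss := psides_sides SS; have vS := vol_side_gt0 hd hM Ss.
have [ND NI] : GammaN <> GammaD /\ GammaN <> GammaI by [].
have [+ _] := side_optimality Ss (psides_disjoint hMGam ND SS).
rewrite SS (negbTE (psides_disjoint hMGam NI SS)) mulr0 mul0r normr_le0.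
rewrite -mulrBr mulf_eq0 (gt_eqF vS) subr_eq0 => /eqP.
by rewrite net_flux_bside //; exact: psides_sub SS.
Qed.

Lemma marini_flux_bounds S : S \in SI ->
  `|bflux marini S| <= L / m /\
  side_value u S * bflux marini S = - (L / m * `|side_value u S|).
Proof.
move=> SS; have Ss := psides_sides SS; have vS := vol_side_gt0 hd hM Ss.
have [ID IN] : GammaI <> GammaD /\ GammaI <> GammaN by [].
have [] := side_optimality Ss (psides_disjoint hMGam ID SS).
rewrite SS (negbTE (psides_disjoint hMGam IN SS)) subr0.
rewrite net_flux_bside; last exact: psides_sub SS.
rewrite (normrM (vol S)) (gtr0_norm vS).
have -> : L * vol S / m = vol S * (L / m) by rewrite mulrAC mulrC.
rewrite ler_pM2l // => -> h; split=> //.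
apply: (mulfI (lt0r_neq0 vS)).
by rewrite mulrCA h; ring.
Qed.

(** In Green's formula for [u] and [marini] the Gamma_I term is -L^2/m, minus twice the penalty of
    [u]. This turns the primal value into a dual expression with that penalty subtracted, and the
    bound L/m on the flux shows that the dual penalty is no larger. *)
Lemma marini_duality : primal_value Om Gam m fh gh u <= dual_value Om Gam m uD marini.
Proof.
have hN : Linfnorm SI (ntrace marini) <= L / m.
  apply: (Linfnorm_le hd hM _ (F := bflux marini)).
  - by move=> S; exact: psides_sides.
  - by move=> S /psides_sides Ss x Sx; rewrite ntrace_side //; exact: RT_marini.
  - apply: divr_ge0; last exact: ltW.
    apply: sumr_ge0 => S /psides_sides Ss.
    by rewrite mulr_ge0 // ltW // (vol_side_gt0 hd hM).
  - by move=> S /marini_flux_bounds[].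
have N0 : 0 <= Linfnorm SI (ntrace marini).
  apply: (Linfnorm_ge0 hd hM _ (F := bflux marini)).
  - by move=> S; exact: psides_sides.
  - by move=> S /psides_sides Ss x Sx; rewrite ntrace_side //; exact: RT_marini.
have := discrete_green hd hM hOm huCR RT_marini.
rewrite (sum_bsides hMGam).
have -> : \sum_(T in Th) vol T *
    (dotv (cgrad u T) (marini T (bary T)) + u T (bary T) * divg (marini T) 0) =
  \sum_(T in Th) vol T * dotv (cgrad u T) (cgrad u T) -
  \sum_(T in Th) vol T * (fh T 0 * u T (bary T)).
  rewrite -sumrB; apply: eq_bigr => T TM; rewrite marini_bary divg_marini; ring.
have -> : \sum_(S in SI) vol S * (side_value u S * bflux marini S) = - (L / m * L).
  rewrite {2}/L mulr_sumr -sumrN; apply: eq_bigr => S SS.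
  by have [_ ->] := marini_flux_bounds SS; ring.
have [_ _ hN'] := iffLR (KrtE hd hM hf hg marini) Krt_marini.
have hDu := iffLR (dirichletE hd hM huD huCR) huDir.
have -> : \sum_(S in SD) vol S * (side_value u S * bflux marini S) =
    \sum_(S in SD) vol S * (bflux marini S * uD S 0).
  by apply: eq_bigr => S SS; rewrite hDu // [uD S 0 * _]mulrC.
have -> : \sum_(S in SN) vol S * (side_value u S * bflux marini S) =
    \sum_(S in SN) vol S * (gh S 0 * side_value u S).
  by apply: eq_bigr => S SS; rewrite hN' // [gh S 0 * _]mulrC.
rewrite /primal_value /dual_value -/L.
have -> : \sum_(T in Th) vol T * dotv (marini T (bary T)) (marini T (bary T)) =
    \sum_(T in Th) vol T * dotv (cgrad u T) (cgrad u T).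
  by apply: eq_bigr => T _; rewrite marini_bary.
have hN2 : m / 2 * Linfnorm SI (ntrace marini) ^+ 2 <= 1 / (2 * m) * L ^+ 2.
  have -> : 1 / (2 * m) * L ^+ 2 = m / 2 * (L / m) ^+ 2.
    by field; rewrite gt_eqF.
  apply: ler_wpM2l; first by rewrite divr_ge0 // ltW.
  by rewrite ler_pXn2r ?nnegrE // (le_trans N0).
have -> : L / m * L = 2 * (1 / (2 * m) * L ^+ 2) by field; rewrite gt_eqF.
lra.
Qed.

End Marini.

Theorem theorem6p4 (R : realType) (d : nat) (hd : (0 < d)%N)
  (Om : set 'rV[R]_d) (Gam : part -> set 'rV[R]_d) (M : mesh R d)
  (hOm : bounded_lipschitz_domain Om)
  (hGam : boundary_splitting Om Gam)
  (hM : triangulation M Om)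
  (hMGam : boundary_fitted M Om Gam)
  (m : R) (hm : 0 < m)
  (fh gh uD : pwfun M)
  (hf : pwpoly 0 (elems M) fh)
  (hg : pwpoly 0 (psides M Om Gam GammaN) gh)
  (huD : pwpoly 0 (psides M Om Gam GammaD) uD)
  (u : pwfun M) (hu : primal_minimizer Om Gam m fh gh uD u)
  (z : pwvec M) (hz : dual_maximizer Om Gam m fh gh uD z)
  (v : pwfun M) (hv : Kcr Om Gam uD v)
  (y : pwvec M) (hy : Krt Om Gam fh gh y) :
  rho2_tot Om Gam m fh gh uD u z v y = eta2_gap Om Gam m fh gh uD v y.
Proof.
have [[uCR uDir] _] := hu; have [zK zmax] := hz; have [vCR vDir] := hv.
have mK := Krt_marini hd hM hOm hMGam hm hf hg huD hu.
have uz : primal_value Om Gam m fh gh u = dual_value Om Gam m uD z.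
  apply/eqP; rewrite eq_le (weak_duality hd hM hOm hMGam hm hf hg huD uCR uDir zK).
  rewrite andbT.
  (* Only values are compared: [z] does at least as well as Marini's field, without being identified
     with it. *)
  apply: (le_trans (marini_duality hd hM hOm hMGam hm hf hg huD hu)).
  have [mRT _ _] := mK; have := zmax _ mRT.
  by rewrite !(DrtE hd hM m huD) // lee_fin.
rewrite /rho2_tot /rho2_I /rho2_D /eta2_gap.
rewrite !(IcrE hd hM m hf hg) // !(DrtE hd hM m huD) // uz.
by rewrite -!EFinN -!EFinD; congr (_%:E); ring.
Qed.
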